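(* For all $u\in\mathrm{Lip}$ and $t\ge0$, one has, pointwise on $X$, $T(t)u\le S(t)u\le I(t)u$ and $$S(t)u-T(t)u\le I(t)u-T(t)u\le t\,\varphi^*\big(e^{ct}\|u\|_{\mathrm{Lip}}\big).$$
   Context: Setting. $(X,\|\cdot\|)$ is a separable Banach space with Borel $\sigma$-algebra $\mathcal B(X)$. $K\colon X\to X$ is a fixed linear operator such that $\{Kx\colon \|x\|\le r\}$ is compact for all $r\ge 0$, $\{Kx\colon x\in X\}$ is dense in $X$, and $\|Kx\|\le\|x\|$ for all $x\in X$. Function spaces. $\mathrm{Lip}$ is the space of all $u\colon X\to\mathbb R$ (not necessarily bounded) with $|u(x_1)-u(x_2)|\le L\|K(x_1-x_2)\|$ for all $x_1,x_2\in X$ and some $L\ge 0$; the smallest such $L$ is $\|u\|_{\mathrm{Lip}}$. $\mathrm{Lip}_{\mathrm b}$ is the set of $u\in\mathrm{Lip}$ with $\|u\|_\infty:=\sup_{x\in X}|u(x)|<\infty$. For bounded continuous functions $u_n\colon X\to\mathbb R$ and $u\colon X\to\mathbb R$, write $u_n\to u$ if $\sup_n\|u_n\|_\infty<\infty$ and $\lim_{n\to\infty}\sup_{\|x\|\le r}|u(x)-u_n(x)|=0$ for all $r\ge 0$. $\mathrm{C}_{\mathrm b}$ is the space of all $u\colon X\to\mathbb R$ for which there is a sequence $(u_n)\subset\mathrm{Lip}_{\mathrm b}$ with $u_n\to u$. Wasserstein distance. Fix $p\in(1,\infty)$. $\mathcal P_p(X)$ is the set of Borel probability measures on $X$ with finite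 $p$-th moment, and $\mathcal W_p(\mu,\nu)=\big(\inf_{\pi\in\mathrm{Cpl}(\mu,\nu)}\int_{X\times X}\|y-z\|^p\,\pi(dy,dz)\big)^{1/p}$, where $\mathrm{Cpl}(\mu,\nu)$ is the set of couplings of $\mu$ and $\nu$. Reference model. $(\mu_t)_{t\ge0}\subset\mathcal P_p(X)$ and $\psi_t\colon X\to X$, $t\ge 0$, are continuous maps such that for all $s,t\ge0$, $u\in\mathrm{C}_{\mathrm b}$, $x\in X$, $$\int_X u(\psi_{t+s}(x)+y)\,\mu_{t+s}(dy)=\int_X\int_X u\big(\psi_s(\psi_t(x)+y_t)+y_s\big)\,\mu_s(dy_s)\,\mu_t(dy_t).$$ Standing assumptions: (A1) there is a constant $c\ge0$ with $\|\psi_t(x_1)-\psi_t(x_2)\|\le e^{ct}\|x_1-x_2\|$ for all $t\ge0$, $x_1,x_2\in X$ (this $c$ is fixed); (A2) $K\psi_t(x)=\psi_t(Kx)$ for all $t\ge0$, $x\in X$, $\psi_0(x)=x$ for all $x\in X$, and $\lim_{h\downarrow0}\sup_{\|x\|\le r}\|\psi_h(Kx)-Kx\|=0$ for all $r\ge0$; (A3) $\lim_{h\downarrow0}\int_X\|y\|^p\,\mu_h(dy)=0$. Penalisation. $\varphi\colon[0,\infty)\to[0,\infty]$ is convex and lower semicontinuous, $\varphi(0)=0$, $\varphi(v)\ne0$ for some $v>0$, and $v\mapsto\varphi(v^{1/p})$ is convex. Its conjugate is $\varphi^*(w)=\sup_{v\ge0}(vw-\varphi(v))$, $w\ge0$.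 Set $\varphi_t(v)=t\varphi(e^{-ct}v/t)$ for $t>0$, $v\ge 0$, and $\varphi_0(v)=\infty$ for $v>0$, $\varphi_0(0)=0$. Operators. For $t\ge0$, $x\in X$ and $u\in\mathrm{Lip}$ define $(T(t)u)(x)=\int_X u(\psi_t(x)+y)\,\mu_t(dy)$ and $(I(t)u)(x)=\sup_{\nu\in\mathcal P_p(X)}\big(\int_X u(\psi_t(x)+z)\,\nu(dz)-\varphi_t(\mathcal W_p(\mu_t,\nu))\big)$; these are well defined, and $I(t)$ maps $\mathrm{Lip}$ to $\mathrm{Lip}$. For $n\in\mathbb N_0$, $t\ge0$: $I^n(t)u:=I(2^{-n})^kI(t-k2^{-n})u$, where $k\in\mathbb N_0$ is the largest integer with $k2^{-n}\le t$, and $S(t)u:=\inf_{n\in\mathbb N_0}I^n(t)u$ (pointwise infimum). *)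

(* Defs.v *)
From mathcomp Require Import all_boot all_order all_algebra.
From mathcomp Require Import all_classical all_reals all_analysis.

Set Implicit Arguments.
Unset Strict Implicit.
Unset Printing Implicit Defensive.

Import Order.TTheory GRing.Theory Num.Theory.
Import numFieldNormedType.Exports.

Local Open Scope classical_set_scope.
Local Open Scope ring_scope.

Definition separable (T : topologicalType) : Prop :=
  exists2 D : set T, countable D & dense D.

(* X equipped with its Borel sigma-algebra. The measurable structure of
   (borel X * borel X) is the product sigma-algebra, which is the Borel
   sigma-algebra of X * X as soon as X is separable. *)
Definition borel {R : realType} (X : completeNormedModType R) :=
  g_sigma_algebraType (@open X).

Definition supnorm {R : realType} (X V : normedModType R) (A : set X)
    (f : X -> V) : \bar R :=
  ereal_sup [set (`|f x|)%:E | x in A].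

Section function_spaces.
Context {R : realType} {X : completeNormedModType R} (K : X -> X).

Definition lip_bound (u : X -> R) (L : R) : Prop :=
  0 <= L /\ forall x1 x2, `|u x1 - u x2| <= L * `|K (x1 - x2)|.

Definition Lip : set (X -> R) := [set u | exists L, lip_bound u L].

Definition lip_norm (u : X -> R) : R := inf [set L | lip_bound u L].

Definition Lipb : set (X -> R) :=
  [set u | Lip u /\ (supnorm setT (u : X -> R^o) < +oo)%E].

Definition mixed_cvg (u_ : nat -> X -> R) (u : X -> R) : Prop :=
  (ereal_sup [set supnorm setT (u_ n : X -> R^o) | n in [set: nat]] < +oo)%E /\
  forall r : R, 0 <= r ->
    supnorm [set x : X | `|x| <= r] ((fun x => u x - u_ n x) : X -> R^o)
      @[n --> \oo] --> 0%E.

Definition Cb : set (X -> R) :=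
  [set u | exists u_ : nat -> X -> R,
     (forall n, Lipb (u_ n)) /\ mixed_cvg u_ u].

End function_spaces.

Section wasserstein.
Context {R : realType} {X : completeNormedModType R} (p : R).
Local Open Scope ereal_scope.

Definition moment (mu : probability (borel X) R) : \bar R :=
  \int[mu]_y ((`|y : X| `^ p)%R)%:E.

Definition Pp : set (probability (borel X) R) := [set mu | moment mu < +oo].

Definition coupling (mu nu : probability (borel X) R) :
    set (probability (borel X * borel X)%type R) :=
  [set pi | forall A : set (borel X), measurable A ->
     pi (A `*` setT) = mu A /\ pi (setT `*` A) = nu A].

Definition transport_cost (mu nu : probability (borel X) R) : \bar R :=
  ereal_inf [set \int[pi]_yz ((`|(yz.1 : X) - (yz.2 : X)| `^ p)%R)%:E
            | pi in coupling mu nu].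

(* The transport cost is finite for mu, nu in Pp (use the product coupling),
   so taking its real part is harmless there. *)
Definition wasserstein (mu nu : probability (borel X) R) : R :=
  (fine (transport_cost mu nu) `^ p^-1)%R.

End wasserstein.

Section penalisation.
Context {R : realType}.
Local Open Scope ereal_scope.

Definition econvex (f : R -> \bar R) : Prop :=
  forall v w l : R, (0 <= v)%R -> (0 <= w)%R -> (0 <= l <= 1)%R ->
    f (l * v + (1 - l) * w)%R <= l%:E * f v + (1 - l)%:E * f w.

(* Only the restriction of phi to [0, +oo[ matters here. *)
Definition penalisation (p : R) (phi : R -> \bar R) : Prop :=
  [/\ (forall v : R, (0 <= v)%R -> 0 <= phi v) /\ phi 0%R = 0,
      econvex phi,
      lower_semicontinuous (phi : subspace (`[0%R, +oo[ : set R) -> \bar R),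
      (exists2 v : R, (0 < v)%R & phi v != 0) &
      econvex (fun v => phi (v `^ p^-1)%R)].

Definition conjugate (phi : R -> \bar R) (w : R) : \bar R :=
  ereal_sup [set (v * w)%:E - phi v | v in (`[0%R, +oo[ : set R)].

Definition scaled (c : R) (phi : R -> \bar R) (t v : R) : \bar R :=
  if t == 0%R then (if v == 0%R then 0 else +oo)
  else t%:E * phi (expR (- (c * t)) * v / t)%R.

End penalisation.

(* The operators act on extended-real functions, so that suprema, infima and
   iterates need no truncation; real functions u enter as EFin \o u. *)
Section operators.
Context {R : realType} {X : completeNormedModType R}.
Variables (p c : R) (phi : R -> \bar R).
Variables (mu : R -> probability (borel X) R) (psi : R -> X -> X).
Local Open Scope ereal_scope.

Definition opT (t : R) (u : X -> \bar R) (x : X) : \bar R :=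
  \int[mu t]_y u (psi t x + y)%R.

Definition opI (t : R) (u : X -> \bar R) (x : X) : \bar R :=
  ereal_sup
    [set \int[nu]_z u (psi t x + z)%R
         - scaled c phi t (wasserstein p (mu t) nu)
     | nu in Pp p].

Definition opIn (n : nat) (t : R) (u : X -> \bar R) : X -> \bar R :=
  let h : R := (2 ^- n)%R in
  let k := Num.truncn (t * 2 ^+ n)%R in
  iter k (opI h) (opI (t - k%:R * h)%R u).

Definition opS (t : R) (u : X -> \bar R) (x : X) : \bar R :=
  ereal_inf [set opIn n t u x | n in [set: nat]].

End operators.

(* Main.v *)
Require Import Defs.
From HB Require Import structures.
From mathcomp Require Import all_boot all_order all_algebra.
From mathcomp Require Import all_classical all_reals all_analysis.
From mathcomp Require Import measurable_realfun ring lra.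

Set Implicit Arguments.
Unset Strict Implicit.
Unset Printing Implicit Defensive.

Import Order.TTheory GRing.Theory Num.Theory.
Import numFieldNormedType.Exports.

Local Open Scope classical_set_scope.
Local Open Scope ring_scope.

(** The lower bound T <= S rests on two facts: T is a semigroup on Lip
    ([opT_semigroup], extended from C_b by clipping), and T <= I because nu = mu_t
    costs nothing.  Since I is monotone, T(t) = T(h)^k T(t - k h) lies below
    I(h)^k I(t - k h) for every step h = 2^-n.

    The bound on I - T is Fenchel's inequality: a coupling of mu_t and nu changes
    the integral of an L-Lipschitz function by at most L W_p(mu_t, nu)
    ([transport_lip]), and L W - phi_t(W) <= t phi*(e^(ct) L) for every W.  As
    v |-> phi(v^(1/p)) is convex, phi grows at least like v^p, so phi* is finite and
    I(t) maps Lip to real-valued functions, which are again in Lip.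

    For S <= I the partition with n = 0 is enough, once I(t) I(s) u <= I(t + s) u is
    known ([opI_comp]).  Composing an almost optimal perturbation nu of mu_t with an
    almost optimal perturbation of mu_s chosen at the end point psi_t(x) + z gives
    one perturbation of mu_(t+s): if (y, z) couples mu_t with nu and (y', w) couples
    mu_s with the chosen law, then
      Y = psi_s(psi_t(x) + y) + y'   and   Z = psi_s(psi_t(x) + z) + w
    satisfy |Z - Y| <= e^(cs) |z - y| + |w - y'|.  Minkowski's inequality bounds the
    cost of moving Y to Z, the scaling of phi_t makes the penalty subadditive
    ([scaled_subadd]), and Jensen's inequality for v |-> phi(v^(1/p)) absorbs the
    dependence of the second law on z ([sum_jensen]).  Three points need care.

    - Selection.  The value I(s) u is Lipschitz, so one almost optimal law for each
      cell of a countable partition of X suffices; outside finitely many cells the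
      law mu_s itself is used, at a cost that tends to 0 with the mass of the tail.

    - Law of Y.  The flow identity of the reference model only tests functions of
      K x, so that it determines the law of K Y and not the law of Y: K need not be
      injective.  The displacement D = Z - Y is therefore transplanted
      ([displace_reference]): a point y drawn from mu_(t+s) is moved by D conditioned
      on K Y lying in the same small cell as K(psi_(t+s)(x) + y).  The p-th moment
      of D is kept exactly, and u, being Lipschitz in K x, is changed arbitrarily
      little.

    - Optimality.  Only almost optimal couplings are used, while phi may jump to
      +oo; a displacement slightly over budget is shrunk linearly onto the budget
      ([opI_ge_displacement]). *)

(** * Image laws and mixtures *)

Section image_law.
Context d1 d2 {T : measurableType d1} {U : measurableType d2} {R : realType}.
Variables (P : probability T R) (f : T -> U).
Hypothesis mf : measurable_fun [set: T] f.

Definition law : probability U R := distribution P (mfun_Sub (mem_set mf)).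

Lemma lawE A : law A = P (f @^-1` A).
Proof. by []. Qed.

Lemma ge0_integral_law (g : U -> \bar R) :
  measurable_fun [set: U] g -> (forall y, 0 <= g y)%E ->
  (\int[law]_y g y = \int[P]_x g (f x))%E.
Proof.
by move=> mg g0; rewrite (ge0_integral_pushforward mf)// => y _; exact: g0.
Qed.

Lemma integral_law (g : U -> \bar R) :
  measurable_fun [set: U] g -> P.-integrable setT (g \o f) ->
  (\int[law]_y g y = \int[P]_x g (f x))%E.
Proof. by move=> mg ig; rewrite (integral_pushforward mf). Qed.

End image_law.

Section mixture.
Local Open Scope ereal_scope.
Context d1 d2 {T1 : measurableType d1} {T2 : measurableType d2} {R : realType}.
Variables (Q : probability T1 R) (i : T1 -> nat) (P : nat -> probability T2 R).
Hypothesis mi : measurable_fun [set: T1] i.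

Let base (_ : unit) : {measure set T1 -> \bar R} := Q.
Let measurable_base U : measurable U -> measurable_fun [set: unit] (base ^~ U).
Proof. by move=> _; exact: measurable_cst. Qed.
HB.instance Definition _ := isKernel.Build _ _ unit T1 R base measurable_base.
Let base_prob x : base x [set: T1] = 1.
Proof. exact: probability_setT. Qed.
HB.instance Definition _ := Kernel_isProbability.Build _ _ unit T1 R base base_prob.

Let fiber_kernel (x : T1) : {measure set T2 -> \bar R} := P (i x).
Let measurable_fiber_kernel U : measurable U ->
  measurable_fun [set: T1] (fiber_kernel ^~ U).
Proof.
move=> mU; rewrite (_ : fiber_kernel ^~ U = (fun n => P n U) \o i)//.
exact: measurableT_comp.
Qed.
HB.instance Definition _ :=
  isKernel.Build _ _ T1 T2 R fiber_kernel measurable_fiber_kernel.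
Let fiber_kernel_prob x : fiber_kernel x [set: T2] = 1.
Proof. exact: probability_setT. Qed.
HB.instance Definition _ :=
  Kernel_isProbability.Build _ _ T1 T2 R fiber_kernel fiber_kernel_prob.

Let fiber (x : unit * T1) : {measure set (T1 * T2) -> \bar R} :=
  law (P (i x.2)) (pair1_measurable x.2).
Let measurable_fiber U : measurable U ->
  measurable_fun [set: unit * T1] (fiber ^~ U).
Proof.
move=> mU.
rewrite (_ : fiber ^~ U = (fun x => fiber_kernel x (xsection U x)) \o snd).
  apply: measurableT_comp => //.
  by apply: measurable_fun_xsection_finite_kernel; rewrite inE.
apply/funext => x /=; rewrite /fiber lawE /fiber_kernel.
by congr (P _ _); apply/seteqP; split => y; rewrite /xsection /= ?inE.
Qed.
HB.instance Definition _ :=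
  isKernel.Build _ _ (unit * T1)%type (T1 * T2)%type R fiber measurable_fiber.
Let fiber_prob x : fiber x [set: T1 * T2] = 1.
Proof. exact: probability_setT. Qed.
HB.instance Definition _ :=
  Kernel_isProbability.Build _ _ (unit * T1)%type (T1 * T2)%type R fiber fiber_prob.

(** The law of (x, y) where x has law Q and, given x, y has law P (i x): a product of
    Q with a kernel that takes countably many values.  Both gluing steps of the proof
    are of this form. *)
Definition mix : set (T1 * T2) -> \bar R := mkcomp base fiber tt.

HB.instance Definition _ := Measure.on mix.

Lemma ge0_integral_mix (f : T1 * T2 -> \bar R) : (forall z, 0 <= f z) ->
  measurable_fun [set: T1 * T2] f ->
  \int[mix]_z f z = \int[Q]_x \int[P (i x)]_y f (x, y).
Proof.
move=> f0 mf; rewrite [LHS]integral_kcomp//; apply: eq_integral => x _.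
by rewrite ge0_integral_law.
Qed.

Let mix_setT : mix [set: T1 * T2] = 1.
Proof.
rewrite -[LHS]mul1e -integral_cst// ge0_integral_mix//=.
under eq_integral do rewrite integral_cst//= probability_setT mul1e.
by rewrite integral_cst//= probability_setT mul1e.
Qed.

HB.instance Definition _ := Measure_isProbability.Build _ _ _ mix mix_setT.

Lemma measurable_fiber_integral (f : T1 * T2 -> \bar R) : (forall z, 0 <= f z) ->
  measurable_fun [set: T1 * T2] f ->
  measurable_fun [set: T1] (fun x => \int[P (i x)]_y f (x, y)).
Proof.
by move=> f0 mf; exact: (measurable_fun_integral_finite_kernel f fiber_kernel).
Qed.

(* used with the positive and the negative part of f as g *)
Let integrable_fiber_part (f g : T1 * T2 -> \bar R) :
  measurable_fun [set: T1 * T2] f ->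
  \int[Q]_x \int[P (i x)]_y `|f (x, y)| < +oo -> (forall z, 0 <= g z) ->
  (forall z, g z <= `|f z|) -> measurable_fun [set: T1 * T2] g ->
  Q.-integrable setT (fun x => \int[P (i x)]_y g (x, y)).
Proof.
move=> mf fint g0 gf mg; apply/integrableP; split; first exact: measurable_fiber_integral.
apply: le_lt_trans fint; apply: ge0_le_integral => //.
- apply: measurableT_comp => //; exact: measurable_fiber_integral.
- apply: (measurable_fiber_integral (f := fun z => `|f z|)) => //.
  exact: measurableT_comp.
- move=> x _; rewrite gee0_abs ?integral_ge0//.
  apply: ge0_le_integral => //.
  + exact: measurableT_comp.
  + by apply: measurableT_comp => //; exact: measurableT_comp.
Qed.

Let fiber_integralE (f : T1 * T2 -> \bar R) x :
  \int[P (i x)]_y f (x, y) =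
  \int[P (i x)]_y f^\+ (x, y) - \int[P (i x)]_y f^\- (x, y).
Proof.
rewrite [LHS]integralE.
by congr (_ - _); apply: eq_integral => y _; rewrite !(funeposE, funenegE).
Qed.

Lemma integrable_fiber (f : T1 * T2 -> \bar R) :
  measurable_fun [set: T1 * T2] f ->
  \int[Q]_x \int[P (i x)]_y `|f (x, y)| < +oo ->
  Q.-integrable setT (fun x => \int[P (i x)]_y f (x, y)).
Proof.
move=> mf fint; under eq_fun do rewrite fiber_integralE.
apply: integrableB => //.
- apply: (integrable_fiber_part mf fint) => //; last exact: measurable_funepos.
  by move=> z; rewrite funeposE ge_max lee_abs abse_ge0.
- apply: (integrable_fiber_part mf fint) => //; last exact: measurable_funeneg.
  by move=> z; rewrite funenegE ge_max -abseN lee_abs abse_ge0.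
Qed.

Lemma integral_mix (f : T1 * T2 -> \bar R) :
  measurable_fun [set: T1 * T2] f ->
  \int[Q]_x \int[P (i x)]_y `|f (x, y)| < +oo ->
  \int[mix]_z f z = \int[Q]_x \int[P (i x)]_y f (x, y).
Proof.
move=> mf fint.
have part g := @integrable_fiber_part f g mf fint.
rewrite [LHS]integralE !ge0_integral_mix//; last 2 first.
  exact: measurable_funeneg.
  exact: measurable_funepos.
rewrite -integralB//.
- by apply: eq_integral => x _; rewrite [RHS]fiber_integralE.
- apply: part => //; last exact: measurable_funepos.
  by move=> z; rewrite funeposE ge_max lee_abs abse_ge0.
- apply: part => //; last exact: measurable_funeneg.
  by move=> z; rewrite funenegE ge_max -abseN lee_abs abse_ge0.
Qed.

Lemma mix_fst A : measurable A -> mix (A `*` setT) = Q A.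
Proof.
move=> mA.
have mAT : measurable (A `*` [set: T2]) by exact: measurableX.
rewrite -[X in mix X]setIT -integral_indic// ge0_integral_mix//=; last first.
  exact/measurable_EFinP/measurable_indic.
rewrite (eq_integral (fun x => (\1_A x)%:E)); last first.
  move=> x _; rewrite (eq_integral (cst (\1_A x)%:E)).
    by rewrite integral_cst//= probability_setT mule1.
  by move=> y _; rewrite /= !indicE; congr (_%:R%:E); rewrite in_setX in_setT andbT.
by rewrite integral_indic// setIT.
Qed.

End mixture.

(** * Borel measurability in a separable Banach space *)

Section borel_measurability.
Context {R : realType} {X : completeNormedModType R}.

Lemma continuous_borel (Y : completeNormedModType R) (f : X -> Y) :
  continuous f -> measurable_fun [set: borel X] (f : borel X -> borel Y).
Proof.
move=> cf; apply: (@measurability _ _ (borel X) (borel Y) _ _ (@open Y)) => //.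
move=> _ [B oB <-]; rewrite setTI; apply: sub_sigma_algebra.
by move/continuousP : cf; exact.
Qed.

Lemma continuous_borel_real (f : X -> R) :
  continuous f -> measurable_fun [set: borel X] (f : borel X -> R).
Proof.
move=> cf; apply: (measurability _ (RGenOpens.measurableE R)).
move=> _ [_ [a [b ->]] <-]; rewrite setTI; apply: sub_sigma_algebra.
by move/continuousP : cf; apply; exact: itv_open.
Qed.

Hypothesis Xsep : separable X.

Lemma dense_seq : exists q : nat -> X,
  forall (x : X) (e : R), 0 < e -> exists n, `|x - q n| < e.
Proof.
case: Xsep => D cD dD; have /pcard_surjP[q Dq] := cD.
exists q => x e e0.
have [|y [xy Dy]] := dD (ball x e) _ (ball_open _ _).
  by exists x; exact: ballxx.
have [n _ qny] := Dq _ Dy; exists n.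
by rewrite qny; rewrite -ball_normE /ball_ in xy.
Qed.

(** An open subset of X * X is a countable union of products of balls centred in a
    countable dense set, hence lies in the product of the Borel sigma-algebras.  This
    is what makes addition, and thus the distance, jointly measurable. *)
Lemma continuous_borel2 (f : X * X -> X) :
  continuous f -> measurable_fun [set: borel X * borel X] (f : _ -> borel X).
Proof.
move=> cf; apply: (@measurability _ _ _ (borel X) _ _ (@open X)) => //.
move=> _ [B oB <-]; rewrite setTI.
have oW : open (f @^-1` B) by move/continuousP : cf; exact.
set W := f @^-1` B in oW *.
have [q qd] := dense_seq.
pose S (k : nat * nat * nat) : set (borel X * borel X) :=
  ball (q k.1.1) (k.2.+1%:R^-1) `*` ball (q k.1.2) (k.2.+1%:R^-1).
have mS k : measurable (S k).
  by apply: measurableX; apply: sub_sigma_algebra; exact: ball_open.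
rewrite (_ : W = \bigcup_k (if `[< S k `<=` W >] then S k else set0)).
  by apply: countable_bigcupT_measurable => [|k]; [exact: countableP|case: ifP].
apply/seteqP; split; last first.
  by move=> z [k _ /=]; case: asboolP => // SW Sz; exact: SW.
move=> [a b] Wab.
have /nbhs_ballP[e /= e0 eW] : nbhs (a, b) W by apply: open_nbhs_nbhs.
have [k ke] : exists k, k.+1%:R^-1 < e / 2.
  have [k _ kP] := near_infty_natSinv_lt (PosNum (divr_gt0 e0 (ltr0n R 2))).
  by exists k; exact: (kP k (leqnn k)).
have k0 : 0 < k.+1%:R^-1 :> R by rewrite invr_gt0 ltr0n.
have [n an] := qd a _ k0; have [m bm] := qd b _ k0.
have close c x y : `|c - q x| < k.+1%:R^-1 -> ball (q x) (k.+1%:R^-1) y ->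
    ball c e y.
  rewrite -!ball_normE /ball_/= => cq qy.
  rewrite (_ : c - y = (c - q x) + (q x - y)); last by rewrite addrA subrK.
  rewrite (le_lt_trans (ler_normD _ _))// (splitr e) ltrD//.
    exact: lt_trans cq ke.
  exact: lt_trans qy ke.
have SW : S (n, m, k) `<=` W.
  by move=> [y1 y2] [/= y1S y2S]; apply: eW; split => /=; apply: close; eassumption.
exists (n, m, k) => //; rewrite asboolT//.
by split => /=; rewrite -ball_normE /ball_/= distrC.
Qed.

Context d (T : measurableType d).
Implicit Types f g : T -> borel X.

Lemma measurable_borelD f g : measurable_fun [set: T] f ->
  measurable_fun [set: T] g ->
  measurable_fun [set: T] ((fun t => (f t : X) + g t) : T -> borel X).
Proof.
move=> mf mg.
pose h (z : X * X) : X := z.1 + z.2.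
have mh : measurable_fun [set: borel X * borel X] (h : _ -> borel X).
  by apply: continuous_borel2 => z; exact: add_continuous.
exact: (measurableT_comp mh (measurable_fun_pair mf mg)).
Qed.

Lemma measurable_borelZ (k : R) f : measurable_fun [set: T] f ->
  measurable_fun [set: T] ((fun t => k *: (f t : X)) : T -> borel X).
Proof.
move=> mf; have mk : measurable_fun [set: borel X] ((fun x : X => k *: x) : borel X -> borel X).
  by apply: continuous_borel => z; exact: scaler_continuous.
exact: (measurableT_comp mk mf).
Qed.

Lemma measurable_borelB f g : measurable_fun [set: T] f ->
  measurable_fun [set: T] g ->
  measurable_fun [set: T] ((fun t => (f t : X) - g t) : T -> borel X).
Proof.
move=> mf mg; under eq_fun do rewrite -scaleN1r.
by apply: measurable_borelD => //; exact: measurable_borelZ.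
Qed.

Lemma measurable_borel_norm f : measurable_fun [set: T] f ->
  measurable_fun [set: T] (fun t => `|f t : X|).
Proof.
move=> mf; have mn : measurable_fun [set: borel X] ((fun x : X => `|x|) : borel X -> R).
  by apply: continuous_borel_real => z; exact: norm_continuous.
exact: (measurableT_comp mn mf).
Qed.
End borel_measurability.

(** * Penalisations *)

Section convex_functions.
Local Open Scope ereal_scope.
Context {R : realType}.

(** The weights may sum to less than 1: the missing mass sits at 0, where g is 0.
    The induction divides by 1 - q N, which is positive unless q N carries all the
    mass. *)
Lemma sum_jensen (g : R -> \bar R) : (forall v : R, (0 <= v)%R -> 0 <= g v) ->
  g 0%R = 0 -> econvex g ->
  forall (N : nat) (q w : nat -> R), (forall i, 0 <= q i)%R ->
    (forall i, 0 <= w i)%R -> (\sum_(i < N) q i <= 1)%R ->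
  g (\sum_(i < N) q i * w i)%R <= \sum_(i < N) (q i)%:E * g (w i).
Proof.
move=> g_ge0 g0 g_cvx; elim => [|N IHN] q w q0 w0; first by rewrite !big_ord0 g0.
rewrite !big_ord_recr/= => qN1.
have sq0 : (0 <= \sum_(i < N) q i)%R by apply: sumr_ge0.
have [qN|qN] := eqVneq (q N) 1%R.
  have {}sq0 : (\sum_(i < N) q i = 0)%R by lra.
  have qi0 (i : 'I_N) : q i = 0%R.
    by have /psumr_eq0P/(_ sq0 i isT) : forall i : 'I_N, true -> (0 <= q i)%R by [].
  rewrite big1 ?add0r; last by move=> i _; rewrite qi0 mul0r.
  rewrite big1 ?add0e; last by move=> i _; rewrite qi0 mul0e.
  by rewrite qN mul1r mul1e.
have {}qN : (0 < 1 - q N)%R by rewrite subr_gt0 lt_neqAle qN/=; lra.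
pose q' i := (q i / (1 - q N))%R.
have q'0 i : (0 <= q' i)%R by rewrite divr_ge0// ltW.
have q'1 : (\sum_(i < N) q' i <= 1)%R.
  by rewrite -mulr_suml ler_pdivrMr// mul1r; lra.
rewrite (_ : (\sum_(i < N) q i * w i)%R =
    ((1 - q N) * \sum_(i < N) q' i * w i)%R); last first.
  rewrite mulr_sumr; apply: eq_bigr => i _; rewrite /q'.
  by field; rewrite gt_eqF.
rewrite addrC (le_trans (g_cvx _ _ _ _ _ _))//.
- by apply: sumr_ge0 => i _; rewrite mulr_ge0.
- by rewrite q0/=; lra.
rewrite addeC leeD2r//.
rewrite (le_trans (lee_wpmul2l _ (IHN q' w q'0 w0 q'1)))//.
  by rewrite lee_fin ltW.
rewrite ge0_sume_distrr//; last by move=> i _; rewrite mule_ge0// ?g_ge0// lee_fin.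
apply: lee_sum => i _; rewrite muleA -EFinM /q'.
by rewrite (_ : ((1 - q N) * (q i / (1 - q N)) = q i)%R)//; field; rewrite gt_eqF.
Qed.

End convex_functions.

Section penalisation_theory.
Local Open Scope ereal_scope.
Context {R : realType}.
Variables (p c : R) (phi : R -> \bar R).
Hypothesis p_gt1 : (1 < p)%R.
Hypothesis c_ge0 : (0 <= c)%R.
Hypothesis phi_pen : penalisation p phi.

Let p_gt0 : (0 < p)%R. Proof. exact: lt_trans p_gt1. Qed.

Let phi_ge0 v : (0 <= v)%R -> 0 <= phi v.
Proof. by case: phi_pen => -[+ _] _ _ _ _; apply. Qed.

Let phi0 : phi 0%R = 0.
Proof. by case: phi_pen => -[]. Qed.

Let phi_cvx : econvex phi.
Proof. by case: phi_pen. Qed.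

Let phi_pcvx : econvex (fun v => phi (v `^ p^-1)%R).
Proof. by case: phi_pen. Qed.

Let powRVK (v : R) : (0 <= v -> (v `^ p) `^ p^-1 = v)%R.
Proof. by move=> v0; rewrite -powRrM mulfV ?gt_eqF// powRr1. Qed.

(** Convexity, with the minimum of phi attained at 0. *)
Lemma phi_mono v w : (0 <= v <= w)%R -> phi v <= phi w.
Proof.
move=> /andP[v0 vw]; have [w0|w0] := eqVneq w 0%R.
  by rewrite (_ : v = w)//; apply/eqP; rewrite eq_le vw w0.
have {}w0 : (0 < w)%R by rewrite lt_neqAle eq_sym w0 (le_trans v0).
have l01 : (0 <= v / w <= 1)%R.
  by rewrite divr_ge0 ?(ltW w0)//= ler_pdivrMr// mul1r.
have := phi_cvx (ltW w0) (lexx 0%R) l01.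
rewrite mulr0 addr0 divfK ?gt_eqF// phi0 mule0 adde0 => /le_trans; apply.
by rewrite gee_pMl//= ?lee_fin ?phi_ge0 ?(ltW w0)//; case/andP : l01.
Qed.

Lemma scaled_ge0 t v : (0 <= t)%R -> (0 <= v)%R -> 0 <= scaled c phi t v.
Proof.
move=> t0 v0; rewrite /scaled; case: ifP => [_|t_neq0]; first by case: ifP.
by rewrite mule_ge0 ?lee_fin// phi_ge0// divr_ge0// mulr_ge0// expR_ge0.
Qed.

Lemma scaled0 t : scaled c phi t 0 = 0.
Proof. by rewrite /scaled eqxx mulr0 mul0r phi0 mule0; case: ifP. Qed.

Lemma scaled_mono t v w : (0 <= t)%R -> (0 <= v <= w)%R ->
  scaled c phi t v <= scaled c phi t w.
Proof.
move=> t0 /andP[v0 vw]; rewrite /scaled; case: ifP => [_|t_neq0].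
  case: (eqVneq w 0%R) => [w0|_]; last by rewrite leey.
  by rewrite eq_le -{1}w0 vw v0.
rewrite lee_wpmul2l ?lee_fin// phi_mono// divr_ge0 ?mulr_ge0 ?expR_ge0//=.
by rewrite ler_wpM2r ?invr_ge0// ler_wpM2l// expR_ge0.
Qed.

Lemma scaled_pcvx t : (0 <= t)%R ->
  econvex (fun v => scaled c phi t (v `^ p^-1)%R).
Proof.
rewrite le_eqVlt => /predU1P[<-|t0] v w l v0 w0 l01; rewrite /scaled.
  rewrite eqxx !powR_eq0 invr_eq0 (gt_eqF p_gt0)/= !andbT.
  case/andP : l01 => l0 l1.
  have [->|ln0] := eqVneq l 0%R.
    by rewrite mul0r add0r subr0 mul1r mul0e add0e mul1e.
  have [->|ln1] := eqVneq l 1%R.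
    by rewrite subrr mul0r addr0 mul1r mul1e mul0e adde0.
  have {}l0 : (0 < l)%R by rewrite lt_neqAle eq_sym ln0.
  have {}l1 : (0 < 1 - l)%R by rewrite subr_gt0 lt_neqAle ln1.
  have [->|vn0] := eqVneq v 0%R; last first.
    rewrite gt0_muley ?lte_fin// addye ?leey//.
    by case: ifP => _; rewrite ?mule0// gt0_muley ?lte_fin.
  have [->|wn0] := eqVneq w 0%R; first by rewrite !mulr0 addr0 eqxx !mule0 adde0.
  by rewrite mule0 add0e gt0_muley ?lte_fin// leey.
rewrite gt_eqF//.
pose k := ((expR (- (c * t)) / t) `^ p)%R.
have e0 : (0 <= expR (- (c * t)) / t)%R by rewrite divr_ge0 ?expR_ge0 ?ltW.
have kE x : (0 <= x)%R ->
    (expR (- (c * t)) * x `^ p^-1 / t = (k * x) `^ p^-1)%R.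
  by move=> x0; rewrite powRM ?powR_ge0// powRVK//; ring.
have lv : (0 <= l * v + (1 - l) * w)%R.
  by case/andP : l01 => *; rewrite addr_ge0// mulr_ge0// subr_ge0.
rewrite !kE//.
rewrite (_ : k * (l * v + (1 - l) * w) = l * (k * v) + (1 - l) * (k * w))%R; last by ring.
have k0 : (0 <= k)%R by exact: powR_ge0.
rewrite (le_trans (lee_wpmul2l _ (phi_pcvx (mulr_ge0 k0 v0) (mulr_ge0 k0 w0) l01)))//.
  by rewrite lee_fin ltW.
case/andP : l01 => l0 l1.
rewrite muleDr//; first by rewrite !muleA -!EFinM ![(_ * t)%R]mulrC.
by apply: ge0_adde_def; rewrite inE mule_ge0 ?lee_fin ?subr_ge0// phi_ge0// powR_ge0.
Qed.

(** The argument e^(-c(t+s)) (e^(cs) a + b) / (t + s) of phi on the left is at most the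
    convex combination of e^(-ct) a / t and e^(-cs) b / s with weights t / (t + s) and
    s / (t + s).  If t or s is 0, the corresponding term is 0 or +oo. *)
Lemma scaled_subadd t s a b : (0 <= t)%R -> (0 <= s)%R -> (0 <= a)%R -> (0 <= b)%R ->
  scaled c phi (t + s) (expR (c * s) * a + b) <=
  scaled c phi t a + scaled c phi s b.
Proof.
move=> + + a0 b0; rewrite le_eqVlt => /predU1P[<-|t0].
  move=> s0; rewrite add0r {2}/scaled eqxx.
  have [->|_] := eqVneq a 0%R; first by rewrite mulr0 add0r add0e.
  by rewrite addye ?leey// gt_eqF// (lt_le_trans ltNy0)// scaled_ge0.
rewrite le_eqVlt => /predU1P[<-|s0].
  rewrite addr0 {3}/scaled eqxx.
  have [->|_] := eqVneq b 0%R; first by rewrite mulr0 expR0 mul1r addr0 adde0.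
  by rewrite addey ?leey// gt_eqF// (lt_le_trans ltNy0)// scaled_ge0// ltW.
have r0 : (0 < t + s)%R by rewrite addr_gt0.
rewrite /scaled !gt_eqF//.
set x := (expR (- (c * t)) * a / t)%R; set y := (expR (- (c * s)) * b / s)%R.
have x0 : (0 <= x)%R by rewrite divr_ge0 ?mulr_ge0 ?expR_ge0// ltW.
have y0 : (0 <= y)%R by rewrite divr_ge0 ?mulr_ge0 ?expR_ge0// ltW.
pose l := (t / (t + s))%R.
have l01 : (0 <= l <= 1)%R.
  rewrite /l divr_ge0 ?(ltW t0) ?(ltW r0)//= ler_pdivrMr// mul1r lerDl.
  exact: ltW.
have lE : (1 - l = s / (t + s))%R by rewrite /l; field; rewrite gt_eqF.
have : phi (expR (- (c * (t + s))) * (expR (c * s) * a + b) / (t + s))%R <=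
    phi (l * x + (1 - l) * y)%R.
  apply: phi_mono; rewrite divr_ge0 ?(ltW r0)//=; last first.
    by rewrite mulr_ge0 ?expR_ge0// addr_ge0// mulr_ge0// expR_ge0.
  rewrite lE /l /x /y mulrDr mulrA -expRD.
  rewrite (_ : (- (c * (t + s)) + c * s = - (c * t))%R); last by ring.
  rewrite (_ : (t / (t + s) * (expR (- (c * t)) * a / t) = expR (- (c * t)) * a / (t + s))%R); last first.
    by field; rewrite !gt_eqF.
  rewrite (_ : (s / (t + s) * (expR (- (c * s)) * b / s) = expR (- (c * s)) * b / (t + s))%R); last first.
    by field; rewrite !gt_eqF.
  rewrite mulrDl lerD2l ler_wpM2r ?invr_ge0 ?(ltW r0)// ler_wpM2r// ler_expR.
  by rewrite lerN2 ler_wpM2l// lerDr ltW.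
move=> /(le_trans)/(_ (phi_cvx x0 y0 l01)) h.
rewrite (le_trans (lee_wpmul2l _ h)) ?lee_fin ?(ltW r0)//.
rewrite muleDr//; last first.
  by apply: ge0_adde_def; rewrite inE mule_ge0 ?phi_ge0// lee_fin ?lE ?divr_ge0 ?ltW.
rewrite !muleA -!EFinM lE /l.
by rewrite (mulrC _ (t / _)%R) (mulrC _ (s / _)%R) !divfK ?gt_eqF.
Qed.

Lemma fenchel t L W : (0 <= t)%R -> (0 <= L)%R -> (0 <= W)%R ->
  (L * W)%:E - scaled c phi t W <= t%:E * conjugate phi (expR (c * t) * L)%R.
Proof.
move=> + L0 W0; rewrite le_eqVlt => /predU1P[<-|t0]; rewrite /scaled.
  rewrite eqxx mul0e; have [->|_] := eqVneq W 0%R; first by rewrite mulr0 sube0.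
  by rewrite addeNy leNye.
rewrite gt_eqF//.
set v := (expR (- (c * t)) * W / t)%R.
have v0 : (0 <= v)%R by rewrite divr_ge0 ?mulr_ge0 ?expR_ge0// ltW.
have -> : (L * W = t * (v * (expR (c * t) * L)))%R.
  rewrite /v expRN; field.
  by rewrite !gt_eqF ?expR_gt0.
have := @ereal_sup_ubound _ [set (v * (expR (c * t) * L))%:E - phi v | v in (`[0%R, +oo[ : set R)] ((v * (expR (c * t) * L))%:E - phi v).
have vin : v \in `[0%R, +oo[ by rewrite in_itv/= v0.
move=> /(_ (ex_intro2 _ _ v vin erefl)) h.
rewrite (le_trans _ (lee_wpmul2l _ h)) ?lee_fin ?(ltW t0)//.
rewrite muleDr//.
by rewrite EFinM muleN.
Qed.

Lemma conjugate_ge0 w : 0 <= conjugate phi w.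
Proof.
apply: ereal_sup_ubound; exists 0%R; first by rewrite /= in_itv/= lexx.
by rewrite mul0r phi0 sube0.
Qed.

(** The convexity of v |-> phi(v^(1/p)) with p > 1 makes phi superlinear. *)
Lemma conjugate_lty w : (0 <= w)%R -> conjugate phi w < +oo.
Proof.
move=> w0.
have [v0 v0_gt0 phiv0] : exists2 v : R, (0 < v)%R & phi v != 0 by case: phi_pen.
have [k k0 kphi] : exists2 k : R, (0 < k)%R & k%:E <= phi v0.
  have : 0 < phi v0 by rewrite lt_neqAle eq_sym phiv0 phi_ge0// ltW.
  by case: (phi v0) => [r r0|_|//]; [exists r|exists 1%R; rewrite ?leey].
(* beyond v0 the penalisation dominates a multiple of the p-th power *)
have growth v : (v0 <= v)%R -> (k * (v / v0) `^ p)%:E <= phi v.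
  move=> vv0; have v_gt0 : (0 < v)%R by exact: lt_le_trans vv0.
  pose l := ((v0 / v) `^ p)%R.
  have l_gt0 : (0 < l)%R by rewrite powR_gt0// divr_gt0.
  have l01 : (0 <= l <= 1)%R.
    have p1 : (1 `^ p = 1 :> R)%R by rewrite powR1.
    rewrite (ltW l_gt0)/= /l -[leRHS]p1 ge0_ler_powR ?nnegrE// ?(ltW p_gt0)//.
      by rewrite divr_ge0// ltW.
    by rewrite ler_pdivrMr// mul1r.
  have /= := phi_pcvx (powR_ge0 v p) (lexx 0%R) l01.
  rewrite mulr0 addr0 {1}/l -powRM ?divr_ge0 ?(ltW v0_gt0) ?(ltW v_gt0)//.
  rewrite divfK ?gt_eqF//.
  rewrite powRVK ?(ltW v0_gt0)// powRVK ?(ltW v_gt0)// powR0 ?invr_eq0 ?gt_eqF//.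
  rewrite phi0 mule0 adde0 => /(le_trans kphi).
  have : 0 <= phi v by exact/phi_ge0/ltW.
  case: (phi v) => [r _|_ _|//]; last by rewrite leey.
  rewrite -EFinM !lee_fin => h.
  have lV : (l * (v / v0) `^ p = 1)%R.
    rewrite /l -powRM ?divr_ge0 ?ltW//.
    by rewrite (_ : (v0 / v * (v / v0) = 1)%R) ?powR1//; field; rewrite !gt_eqF.
  by rewrite -[leRHS]mul1r -lV mulrAC ler_wpM2r// powR_ge0.
(* V is where the p-th power overtakes the linear function v w *)
pose V := Num.max v0 ((w * v0 `^ p / k) `^ (p - 1)^-1)%R.
have V0 : (0 <= V)%R by rewrite le_max (ltW v0_gt0).
apply: (@le_lt_trans _ _ (V * w)%:E); last exact: ltry.
apply: ge_ereal_sup => _ [v /= + <-]; rewrite in_itv/= andbT => v_ge0.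
have [vV|Vv] := leP v V.
  rewrite (@le_trans _ _ (v * w)%:E)//; last by rewrite lee_fin ler_wpM2r.
  by rewrite -[leRHS]sube0 leeB// phi_ge0.
rewrite (@le_trans _ _ 0)//; last by rewrite lee_fin mulr_ge0.
have v0v : (v0 <= v)%R by rewrite (le_trans _ (ltW Vv))// le_max lexx.
have v_gt0 : (0 < v)%R by exact: lt_le_trans v0v.
rewrite sube_le0 (le_trans _ (growth v v0v))// lee_fin.
have p1 : (0 < p - 1)%R by rewrite subr_gt0.
have kw0 : (0 <= w * v0 `^ p / k)%R by rewrite divr_ge0 ?mulr_ge0 ?powR_ge0 ?(ltW k0).
have hv : (w * v0 `^ p / k <= v `^ (p - 1))%R.
  have -> : (w * v0 `^ p / k = ((w * v0 `^ p / k) `^ (p - 1)^-1) `^ (p - 1))%R.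
    by rewrite -powRrM mulVf ?gt_eqF// powRr1.
  rewrite ge0_ler_powR ?nnegrE ?powR_ge0 ?(ltW p1)//.
  by rewrite (le_trans _ (ltW Vv))// le_max lexx orbT.
have v0p : (0 < v0 `^ p)%R by rewrite powR_gt0.
have vE : ((v / v0) `^ p = v * v `^ (p - 1) / v0 `^ p)%R.
  have -> : (v * v `^ (p - 1) = v `^ p)%R.
    rewrite -{1}[v]powRr1// -powRD; last by rewrite (gt_eqF v_gt0) implybT.
    by congr (_ `^ _)%R; ring.
  apply: (mulIf (lt0r_neq0 v0p)); rewrite divfK ?gt_eqF// -powRM ?divr_ge0 ?ltW//.
  by rewrite divfK ?gt_eqF.
rewrite vE (_ : (k * (v * v `^ (p - 1) / v0 `^ p) = v * (v `^ (p - 1) * (k / v0 `^ p)))%R); last by ring.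
rewrite ler_wpM2l// -ler_pdivrMr ?divr_gt0// invf_div.
by rewrite mulrA.
Qed.

End penalisation_theory.

(** * Moments *)

Section moments.
Local Open Scope ereal_scope.
Context d {T : measurableType d} {R : realType} (P : probability T R) (p : R).
Hypothesis p_gt1 : (1 < p)%R.
Implicit Types f g h : T -> R.

Let p_gt0 : (0 < p)%R. Proof. exact: lt_trans p_gt1. Qed.

Let le_of_eq (x y : R) : x = y -> (x <= y)%R. Proof. by move=> ->. Qed.

Lemma measurable_EFin_powR f : measurable_fun [set: T] f ->
  measurable_fun [set: T] (fun x => (f x `^ p)%:E).
Proof.
by move=> mf; apply/measurable_EFinP; exact: (measurableT_comp (measurable_powR p) mf).
Qed.

(** Minkowski's inequality for bounds a and b on the p-norms.  Convexity of the p-th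
    power with weights a / (a + b) and b / (a + b) gives it pointwise. *)
Lemma pnorm_triangle f g h a b : (0 < a)%R -> (0 < b)%R ->
  measurable_fun [set: T] f -> measurable_fun [set: T] g ->
  measurable_fun [set: T] h ->
  (forall x, 0 <= f x)%R -> (forall x, 0 <= g x)%R ->
  (forall x, 0 <= h x <= f x + g x)%R ->
  \int[P]_x (f x `^ p)%:E <= (a `^ p)%:E ->
  \int[P]_x (g x `^ p)%:E <= (b `^ p)%:E ->
  \int[P]_x (h x `^ p)%:E <= ((a + b) `^ p)%:E.
Proof.
move=> a0 b0 mf mg mh f0 g0 hfg fa gb.
have ab0 : (0 < a + b)%R by rewrite addr_gt0.
pose l := (a / (a + b))%R.
have l0 : (0 <= l)%R by rewrite divr_ge0 ?(ltW a0) ?(ltW ab0).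
have l1 : (l <= 1)%R by rewrite ler_pdivrMr// mul1r lerDl ltW.
have lE : (1 - l = b / (a + b))%R by rewrite /l; field; rewrite gt_eqF.
pose A := ((a + b) `^ p * l / a `^ p)%R.
pose B := ((a + b) `^ p * (1 - l) / b `^ p)%R.
have A0 : (0 <= A)%R by apply: divr_ge0; [apply: mulr_ge0|]; rewrite ?powR_ge0.
have l1' : (0 <= 1 - l)%R by rewrite subr_ge0.
have B0 : (0 <= B)%R by apply: divr_ge0; [apply: mulr_ge0|]; rewrite ?powR_ge0.
have ap : (0 < a `^ p)%R by rewrite powR_gt0.
have bp : (0 < b `^ p)%R by rewrite powR_gt0.
have divp x y : (0 <= x)%R -> (0 < y)%R -> ((x / y) `^ p = x `^ p / y `^ p)%R.
  move=> x0 y0; have yp : (0 < y `^ p)%R by rewrite powR_gt0.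
  apply: (mulIf (lt0r_neq0 yp)); rewrite divfK ?gt_eqF// -powRM ?divr_ge0 ?(ltW y0)//.
  by rewrite divfK ?gt_eqF.
have pw x : (h x `^ p <= A * f x `^ p + B * g x `^ p)%R.
  have /andP[hx0 hx] := hfg x.
  rewrite (@le_trans _ _ ((f x + g x) `^ p)%R)//.
    by rewrite ge0_ler_powR ?nnegrE ?(ltW p_gt0)// addr_ge0.
  rewrite (_ : (f x + g x = (a + b) * (l * (f x / a) + (1 - l) * (g x / b)))%R); last first.
    by rewrite lE /l; field; rewrite !gt_eqF.
  have fa0 : (0 <= f x / a)%R by rewrite divr_ge0 ?(ltW a0).
  have gb0 : (0 <= g x / b)%R by rewrite divr_ge0 ?(ltW b0).
  rewrite powRM ?(ltW ab0)//; last by rewrite addr_ge0// mulr_ge0// subr_ge0.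
  have := @convex_powR R p (ltW p_gt1) (Itv01 l0 l1) (f x / a)%R (g x / b)%R.
  rewrite !inE/= !in_itv/= !andbT => /(_ fa0 gb0).
  rewrite !convRE/= /unstable.onem => /(ler_wpM2l (powR_ge0 (a + b) p)) /le_trans; apply.
  by rewrite !divp// mulrDr /A /B; apply: le_of_eq; ring.
apply: (@le_trans _ _ (\int[P]_x (A%:E * (f x `^ p)%:E + B%:E * (g x `^ p)%:E))).
  apply: ge0_le_integral => //.
  - by move=> x _; rewrite lee_fin powR_ge0.
  - exact: measurable_EFin_powR.
  - by apply: emeasurable_funD; apply: measurable_funeM; exact: measurable_EFin_powR.
  - by move=> x _; rewrite -!EFinM -EFinD lee_fin.
rewrite ge0_integralD//; last 4 first.
  - by move=> x _; rewrite -EFinM lee_fin mulr_ge0// powR_ge0.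
  - by apply: measurable_funeM; exact: measurable_EFin_powR.
  - by move=> x _; rewrite -EFinM lee_fin mulr_ge0// powR_ge0.
  - by apply: measurable_funeM; exact: measurable_EFin_powR.
rewrite !ge0_integralZl//; try exact: measurable_EFin_powR;
  try by move=> x _; rewrite lee_fin powR_ge0.
apply: (@le_trans _ _ (A%:E * (a `^ p)%:E + B%:E * (b `^ p)%:E)).
  by rewrite leeD// lee_wpmul2l.
rewrite -!EFinM -EFinD lee_fin /A /B !divfK ?gt_eqF//.
by apply: le_of_eq; ring.
Qed.

Lemma mean_le_pnorm f a : (0 <= a)%R -> measurable_fun [set: T] f ->
  (forall x, 0 <= f x)%R -> \int[P]_x (f x `^ p)%:E <= (a `^ p)%:E ->
  \int[P]_x (f x)%:E <= a%:E.
Proof.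
move=> a0 mf f0.
wlog {a0} a_gt0 : a / (0 < a)%R => [pos fa|fa].
  apply/lee_addgt0Pr => e e0; rewrite -EFinD; apply: pos.
    by rewrite ltr_wpDl.
  rewrite (le_trans fa)// lee_fin ge0_ler_powR ?nnegrE ?(ltW p_gt0)//.
    by rewrite addr_ge0// ltW.
  by rewrite lerDl ltW.
have ap : (0 < a `^ p)%R by rewrite powR_gt0.
pose q := (p / (p - 1))%R.
have p1 : (0 < p - 1)%R by rewrite subr_gt0.
have q0 : (0 < q)%R by rewrite divr_gt0.
have pq : (p^-1 + q^-1 = 1)%R by rewrite /q; field; rewrite !gt_eqF.
pose A := (a / p / a `^ p)%R.
have A0 : (0 <= A)%R.
  by apply: divr_ge0; [apply: divr_ge0; exact: ltW|exact: powR_ge0].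
(* Young's inequality applied to f / a and 1 *)
have pw x : (f x <= A * f x `^ p + a / q)%R.
  have fa0 : (0 <= f x / a)%R by rewrite divr_ge0 ?(ltW a_gt0).
  have := conjugate_powR fa0 (@ler01 R) p_gt0 q0 pq.
  rewrite mulr1 powR1 => /(ler_wpM2l (ltW a_gt0)).
  rewrite mulrC divfK ?gt_eqF// => /le_trans; apply.
  have -> : ((f x / a) `^ p = f x `^ p / a `^ p)%R.
    apply: (mulIf (lt0r_neq0 ap)).
    by rewrite divfK ?gt_eqF// -powRM ?(ltW a_gt0)// divfK ?gt_eqF.
  by rewrite /A; apply: le_of_eq; ring.
apply: (@le_trans _ _ (\int[P]_x (A%:E * (f x `^ p)%:E + cst (a / q)%:E x))).
  apply: ge0_le_integral => //.
  - by move=> x _; rewrite lee_fin.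
  - exact/measurable_EFinP.
  - by apply: emeasurable_funD => //; apply: measurable_funeM; exact: measurable_EFin_powR.
  - by move=> x _; rewrite -!EFinM -EFinD lee_fin.
rewrite ge0_integralD//; last 3 first.
  - by move=> x _; rewrite -EFinM lee_fin mulr_ge0// powR_ge0.
  - by apply: measurable_funeM; exact: measurable_EFin_powR.
  - by move=> x _; rewrite lee_fin divr_ge0 ?(ltW a_gt0) ?(ltW q0).
rewrite ge0_integralZl//; [|exact: measurable_EFin_powR|by move=> x _; rewrite lee_fin powR_ge0].
rewrite integral_cst//= probability_setT mule1.
apply: (@le_trans _ _ (A%:E * (a `^ p)%:E + (a / q)%:E)).
  by rewrite leeD2r// lee_wpmul2l.
rewrite -!EFinM -EFinD lee_fin /A !divfK ?gt_eqF//.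
by rewrite -[leRHS]mulr1 -pq mulrDr.
Qed.

End moments.

(** * Integrals of Lipschitz functions *)

Section integral_comparison.
Local Open Scope ereal_scope.
Context d {T : measurableType d} {R : realType} (P : probability T R).

Lemma le_integral_add (f g h : T -> R) (e : R) :
  P.-integrable setT (EFin \o f) -> P.-integrable setT (EFin \o g) ->
  measurable_fun [set: T] h -> (forall x, 0 <= h x)%R ->
  (forall x, f x <= g x + h x)%R -> \int[P]_x (h x)%:E <= e%:E ->
  \int[P]_x (f x)%:E <= \int[P]_x (g x)%:E + e%:E.
Proof.
move=> fi gi mh h0 fgh he.
have hi : P.-integrable setT (EFin \o h).
  apply/integrableP; split; first exact/measurable_EFinP.
  rewrite (@le_lt_trans _ _ e%:E) ?ltry// (le_trans _ he)//.
  rewrite le_eqVlt; apply/orP; left; apply/eqP; apply: eq_integral => x _ /=.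
  by rewrite ger0_norm.
rewrite (@le_trans _ _ (\int[P]_x ((g x)%:E + (h x)%:E)))//.
  apply: le_integral => //; first exact: integrableD.
  by move=> x _; rewrite -EFinD lee_fin.
by rewrite integralD// leeD2l.
Qed.

End integral_comparison.

Section index_cells.
Context {R : realType} {X : completeNormedModType R}.
Variables (q : nat -> X) (eta : R).
Hypothesis qd : forall (x : X) (e : R), 0 < e -> exists n, `|x - q n| < e.
Hypothesis eta0 : 0 < eta.

(** The first centre q n within distance eta; the fibres of [cell] partition X into
    countably many Borel sets of diameter at most 2 eta. *)
Definition cell (x : X) : nat := ex_minn (qd x eta0).

Lemma cellP x : `|x - q (cell x)| < eta.
Proof. by rewrite /cell; case: ex_minnP. Qed.

Lemma measurable_cell : measurable_fun [set: borel X] (cell : borel X -> nat).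
Proof.
apply: (measurability _ NGenCInfty.measurableE) => _ [_ [n ->] <-].
rewrite setTI.
rewrite (_ : cell @^-1` `[n, +oo[ = ~` \bigcup_(j in [set j | (j < n)%N]) ball (q j) eta).
  apply: measurableC; apply: sub_sigma_algebra; apply: bigcup_open => j _.
  exact: ball_open.
apply/seteqP; split => [x /=|x /= xn].
  rewrite in_itv/= andbT => nx [j /= jn]; rewrite -ball_normE /ball_/= distrC => xj.
  have : (cell x <= j)%N by rewrite /cell; case: ex_minnP => k _; apply.
  by move=> /leq_ltn_trans/(_ jn); rewrite ltnNge => /negP; apply.
rewrite in_itv/= andbT leNgt; apply/negP => xn'; apply: xn.
exists (cell x) => //; rewrite -ball_normE /ball_/= distrC; exact: cellP.
Qed.

End index_cells.

Section lipschitz.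
Local Open Scope ereal_scope.
Context {R : realType} {X : completeNormedModType R} (K : {linear X -> X}).
Hypothesis Kcontr : forall x : X, (`|K x| <= `|x|)%R.

Lemma dist_bound_continuous {V W : normedModType R} (f : V -> W) (C : R) :
  (forall x y, `|f x - f y| <= C * `|x - y|)%R -> continuous f.
Proof.
move=> fC x; apply/cvgrPdist_lt => e e0.
have C0 : (0 < `|C| + 1)%R by rewrite ltr_wpDl.
near=> y; rewrite (le_lt_trans (fC _ _))//.
rewrite (@le_lt_trans _ _ ((`|C| + 1) * `|x - y|)%R)//.
  by apply: ler_wpM2r => //; apply: le_trans (ler_norm C) _; rewrite lerDl.
rewrite mulrC -ltr_pdivlMr//; near: y.
by apply: cvgr_dist_lt => //; rewrite divr_gt0.
Unshelve. all: end_near. Qed.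

Lemma K_continuous : continuous K.
Proof.
by apply: (@dist_bound_continuous _ _ K 1%R) => x y; rewrite mul1r -raddfB; exact: Kcontr.
Qed.

Variables (u : X -> R) (L : R).
Hypothesis uL : lip_bound K u L.

Let L0 : (0 <= L)%R. Proof. by case: uL. Qed.

Lemma lip_dist x y : (`|u x - u y| <= L * `|x - y|)%R.
Proof. by case: uL => _ /(_ x y)/le_trans; apply; rewrite ler_wpM2l. Qed.

Lemma lip_le x y : (u x <= u y + L * `|x - y|)%R.
Proof. by rewrite -lerBlDl (le_trans (ler_norm _))// lip_dist. Qed.

Lemma lip_continuous : continuous u.
Proof. exact: (@dist_bound_continuous _ R^o u L lip_dist). Qed.

Lemma lip_measurable : measurable_fun [set: borel X] (u : borel X -> R).
Proof. exact: continuous_borel_real lip_continuous. Qed.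

Context d {T : measurableType d} (P : probability T R) (Y : T -> borel X).
Hypothesis Xsep : separable X.
Hypothesis mY : measurable_fun [set: T] Y.
Hypothesis iY : \int[P]_w (`|Y w : X|)%:E < +oo.

Lemma norm_integrable : P.-integrable setT (fun w => (`|Y w : X|)%:E).
Proof.
apply/integrableP; split; first exact/measurable_EFinP/measurable_borel_norm.
rewrite (eq_integral (fun w => (`|Y w : X|)%:E))// => w _.
by rewrite /= ger0_norm.
Qed.

Lemma lip_integrable : P.-integrable setT (EFin \o (u \o Y)).
Proof.
apply: (@le_integrable _ _ _ P _ measurableT _
    (fun w => (`|u 0|)%:E + L%:E * (`|Y w : X|)%:E)) => //.
- by apply/measurable_EFinP; exact: (measurableT_comp lip_measurable mY).
- move=> w _ /=; rewrite lee_fin.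
  rewrite [leRHS]ger0_norm ?addr_ge0 ?mulr_ge0//.
  rewrite [leRHS]addrC -lerBlDr (le_trans (lerB_dist _ _))//.
  by rewrite (le_trans (lip_dist _ _))// subr0.
- apply: integrableD => //; first exact: finite_measure_integrable_cst.
  by apply: integrableZl => //; exact: norm_integrable.
Qed.

End lipschitz.

(** * Transplanting a displacement onto the reference law *)

Section conditioning.
Local Open Scope ereal_scope.
Context d {T : measurableType d} {R : realType} (P : probability T R).
Variable f : T -> nat.
Hypothesis mf : measurable_fun [set: T] f.

Let mF i : measurable (f @^-1` [set i]).
Proof. by rewrite -[X in measurable X]setTI; exact: mf. Qed.

(** The law P conditioned on f = i, and P itself if that event is null. *)
Definition cond_index (i : nat) : probability T R := mnormalize (mrestr P (mF i)) P.

Lemma cond_indexE i B : measurable B ->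
  P (f @^-1` [set i]) * cond_index i B = P (B `&` f @^-1` [set i]).
Proof.
move=> mB; rewrite /cond_index/= /mnormalize /= /mrestr setTI.
have fin : P (f @^-1` [set i]) \is a fin_num by exact: fin_num_measure.
have [P0|P0] := eqVneq (P (f @^-1` [set i])) 0.
  rewrite /= P0 mul0e; apply/esym/eqP; rewrite eq_le measure_ge0 andbT -P0.
  by apply: le_measure; rewrite ?inE//; exact: measurableI.
case: ifPn => [/orP[//|/eqP Poo]|_]; first by rewrite Poo in fin.
rewrite muleCA -{1}(fineK fin) -EFinM mulfV ?mule1//.
by rewrite fine_eq0.
Qed.

(** Drawing w from P and then resampling it conditionally on the value of f does not
    change the law of w. *)
Lemma integral_cond_index (B : nat -> set T) : (forall i, measurable (B i)) ->
  \int[P]_w cond_index (f w) (B (f w)) = P [set w | B (f w) w].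
Proof.
move=> mB.
have cover : [set: T] = \bigcup_i f @^-1` [set i].
  by apply/seteqP; split => // w _; exists (f w).
have triv : trivIset setT (fun i => f @^-1` [set i]).
  by move=> i j _ _ [w []] /= <- <-.
rewrite cover ge0_integral_bigcup//; last first.
  rewrite -cover.
  exact: (measurableT_comp (_ : measurable_fun setT (fun i => cond_index i (B i))) mf).
rewrite (_ : [set w | _] = \bigcup_i (B i `&` f @^-1` [set i])); last first.
  apply/seteqP; split => [w Bw|w [i _] [Bw /= fw]]; last by rewrite /= fw.
  by exists (f w).
rewrite measure_bigcup//; last 2 first.
  by move=> i _; exact: measurableI.
  by apply: trivIset_setIl.
rewrite [RHS](@eq_eseriesl _ _ xpredT); last by move=> i; rewrite in_setT.
apply: eq_eseriesr => i _.
transitivity (P (f @^-1` [set i]) * cond_index i (B i)); last exact: cond_indexE.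
rewrite muleC -integral_cst//.
by apply: eq_integral => w; rewrite inE /= => ->.
Qed.

End conditioning.

Section displace_reference.
Local Open Scope ereal_scope.
Context {R : realType} {X : completeNormedModType R} (K : {linear X -> X}).
Hypothesis Kcontr : forall x : X, (`|K x| <= `|x|)%R.
Hypothesis Xsep : separable X.
Variable p : R.
Hypothesis p_gt1 : (1 < p)%R.

Let p_gt0 : (0 < p)%R. Proof. exact: lt_trans p_gt1. Qed.

Lemma moment_bound (mu : probability (borel X) R) : Pp p mu ->
  exists2 b : R, (0 < b)%R & moment p mu <= (b `^ p)%:E.
Proof.
rewrite /Pp/= => mu_lty; exists (fine (moment p mu) `^ p^-1 + 1)%R.
  by rewrite ltr_wpDl// powR_ge0.
have m0 : 0 <= moment p mu.
  by apply: integral_ge0 => x _; rewrite lee_fin powR_ge0.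
rewrite -[leLHS]fineK ?ge0_fin_numE// lee_fin.
have {1}-> : fine (moment p mu) = ((fine (moment p mu) `^ p^-1) `^ p)%R.
  by rewrite -powRrM mulVf ?gt_eqF// powRr1// fine_ge0.
rewrite ge0_ler_powR ?nnegrE ?powR_ge0 ?(ltW p_gt0) ?lerDl//.
by rewrite addr_ge0// powR_ge0.
Qed.

Lemma borel_id_measurable : measurable_fun [set: borel X] (id : borel X -> borel X).
Proof. exact: measurable_id. Qed.

Lemma Pp_norm (mu : probability (borel X) R) : Pp p mu ->
  \int[mu]_y (`|y : X|)%:E < +oo.
Proof.
move=> /moment_bound[b b0 mub]; apply: (@le_lt_trans _ _ b%:E); last exact: ltry.
apply: (@mean_le_pnorm _ _ _ mu p) => //; first exact: ltW.
exact: measurable_borel_norm borel_id_measurable.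
Qed.

Lemma measurable_borelDl (x : X) :
  measurable_fun [set: borel X] ((fun y : X => x + y)%R : borel X -> borel X).
Proof. by apply: measurable_borelD => //; exact: borel_id_measurable. Qed.

Lemma norm_addr_lty d (T : measurableType d) (P : probability T R)
    (Y D : T -> borel X) :
  measurable_fun [set: T] Y -> measurable_fun [set: T] D ->
  \int[P]_w (`|Y w : X|)%:E < +oo -> \int[P]_w (`|D w : X|)%:E < +oo ->
  \int[P]_w (`|(Y w : X) + D w|%R)%:E < +oo.
Proof.
move=> mY mD iY iD.
apply: (@le_lt_trans _ _ (\int[P]_w ((`|Y w : X|)%:E + (`|D w : X|)%:E))).
  apply: ge0_le_integral => //.
  - by apply/measurable_EFinP/measurable_borel_norm; exact: measurable_borelD.
  - by apply: emeasurable_funD; exact/measurable_EFinP/measurable_borel_norm.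
  - by move=> w _; rewrite -EFinD lee_fin ler_normD.
rewrite ge0_integralD//; last 2 first.
  exact/measurable_EFinP/measurable_borel_norm.
  exact/measurable_EFinP/measurable_borel_norm.
by rewrite lte_add_pinfty.
Qed.

Context d {T : measurableType d} (P : probability T R).
Variables (Y D : T -> borel X) (mu : probability (borel X) R) (m : X).
Hypothesis mY : measurable_fun [set: T] Y.
Hypothesis mD : measurable_fun [set: T] D.
Hypothesis iY : \int[P]_w (`|Y w : X|)%:E < +oo.
Hypothesis mu_Pp : Pp p mu.
Hypothesis lawK : forall B : set X, measurable (B : set (borel X)) ->
  P [set w | B (K (Y w))] = mu [set y | B (K (m + y)%R)].

(** Only the laws of K Y and of K (m + y) under mu are assumed to agree.  The pair
    (y, w) is drawn from M, in which w is resampled from P conditioned on K (Y w) lying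
    in the cell of K (m + y); nu is the law of y + D w.  Under M the second coordinate
    still has law P, so that D keeps its moments, and m + y is close to Y w after
    applying K, which is all that u sees. *)
Lemma displace_reference (u : X -> R) (L a e : R) : lip_bound K u L -> (0 <= a)%R ->
  \int[P]_w ((`|D w : X| `^ p)%R)%:E <= (a `^ p)%:E -> (0 < e)%R ->
  exists nu : probability (borel X) R, [/\ Pp p nu,
    transport_cost p mu nu <= (a `^ p)%:E &
    \int[P]_w (u ((Y w : X) + D w)%R)%:E <=
      \int[nu]_z (u (m + z)%R)%:E + e%:E].
Proof.
move=> uL a0 Da e0; have L0 : (0 <= L)%R by case: uL.
have [q qd] := dense_seq Xsep.
pose eta : R := (e / (2 * (L + 1)))%R.
have L1 : (0 < 2 * (L + 1))%R by rewrite mulr_gt0// ltr_wpDl.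
have eta0 : (0 < eta)%R by rewrite divr_gt0.
pose cl := cell qd eta0.
have mKb : measurable_fun [set: borel X] (K : borel X -> borel X).
  by apply: continuous_borel; exact: K_continuous.
have mcK : measurable_fun [set: borel X] ((fun x => cl (K x)) : borel X -> nat).
  exact: (measurableT_comp (measurable_cell qd eta0) mKb).
have mi : measurable_fun [set: borel X] ((fun y => cl (K (m + y)%R)) : borel X -> nat).
  exact: (measurableT_comp mcK (measurable_borelDl m)).
have mf : measurable_fun [set: T] (fun w => cl (K (Y w))).
  exact: (measurableT_comp mcK mY).
pose M : probability (borel X * T)%type R := mix mu (cond_index P mf) mi.
(* the cells of K Y under P have the same masses as those of K (m + y) under mu *)
have transfer (B : nat -> set T) : (forall i, measurable (B i)) ->
    \int[mu]_y cond_index P mf (cl (K (m + y)%R)) (B (cl (K (m + y)%R))) =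
    P [set w | B (cl (K (Y w))) w].
  move=> mB; rewrite -(integral_cond_index P mf)//.
  pose g (i : nat) := cond_index P mf i (B i).
  have mg : measurable_fun [set: borel X] ((g \o cl) : borel X -> \bar R).
    exact: (measurableT_comp (_ : measurable_fun setT g) (measurable_cell qd eta0)).
  have mKm := measurableT_comp mKb (measurable_borelDl m).
  have mKY := measurableT_comp mKb mY.
  have -> : \int[mu]_y g (cl (K (m + y)%R)) = \int[law mu mKm]_x (g \o cl) x.
    by rewrite ge0_integral_law// => x; exact: measure_ge0.
  have -> : \int[P]_w g (cl (K (Y w))) = \int[law P mKY]_x (g \o cl) x.
    by rewrite ge0_integral_law// => x; exact: measure_ge0.
  by apply: eq_measure_integral => B' mB' _; exact/esym/(lawK mB').
have M_snd B : measurable B -> M [set z | B z.2] = P B.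
  by move=> mB; exact: (transfer (fun=> B)).
(* M almost surely pairs points of the same cell *)
pose N : set (borel X * T) := [set z | cl (K (m + z.1)%R) != cl (K (Y z.2))].
have mN : measurable N.
  have m1 : measurable_fun [set: borel X * T] (fun z : borel X * T => cl (K (m + z.1)%R)).
    exact: (measurableT_comp mi measurable_fst).
  have m2 : measurable_fun [set: borel X * T] (fun z : borel X * T => cl (K (Y z.2))).
    exact: (measurableT_comp mf measurable_snd).
  rewrite (_ : N = ~` \bigcup_i
      ((fun z : borel X * T => cl (K (m + z.1)%R)) @^-1` [set i] `&`
       (fun z : borel X * T => cl (K (Y z.2))) @^-1` [set i])).
    apply: measurableC; apply: bigcupT_measurable => i; apply: measurableI.
      by rewrite -[X in measurable X]setTI; exact: m1.
    by rewrite -[X in measurable X]setTI; exact: m2.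
  apply/seteqP; split => z /=; rewrite /N /=.
    by move=> /eqP ne [i _ [/= zi zj]]; apply: ne; rewrite zi zj.
  by move=> h; apply/eqP => zE; apply: h; exists (cl (K (Y z.2))).
have MN : M N = 0.
  transitivity (P [set w | cl (K (Y w)) != cl (K (Y w))]).
    apply: (transfer (fun i => [set w | i != cl (K (Y w))])) => i.
    rewrite (_ : [set w | _] = ~` ((fun w => cl (K (Y w))) @^-1` [set i])).
      by apply: measurableC; rewrite -[_ @^-1` _]setTI; exact: (mf measurableT).
    by apply/seteqP; split => w /= => [/eqP ne iE|ne]; [apply: ne|apply/eqP => iE; apply: ne].
  by rewrite (_ : [set w | _] = set0) ?measure0//; apply/seteqP; split => w //=; rewrite eqxx.
have mKdist : measurable_fun [set: borel X * T]
    (fun z : borel X * T => L * `|K (m + z.1) - K (Y z.2)|)%R.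
  apply: measurable_funM => //.
  apply: measurable_borel_norm; apply: measurable_borelB => //.
    exact: (measurableT_comp mKb (measurableT_comp (measurable_borelDl m) measurable_fst)).
  exact: (measurableT_comp mKb (measurableT_comp mY measurable_snd)).
have M_close : \int[M]_z (L * `|K (m + z.1) - K (Y z.2)|)%R%:E <= e%:E.
  apply: (@le_trans _ _ (\int[M]_z (cst (L * (eta + eta))%R%:E z))).
    apply: ae_ge0_le_integral => //.
    - by move=> z _; rewrite lee_fin mulr_ge0.
    - exact/measurable_EFinP.
    - by move=> z _; rewrite lee_fin mulr_ge0// addr_ge0// ltW.
    - exists N; split => // z /=; rewrite /N/= => h; apply/eqP => cE; apply: h => _.
      rewrite lee_fin ler_wpM2l//.
      have := cellP qd eta0 (K (m + z.1)%R); have := cellP qd eta0 (K (Y z.2)).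
      rewrite -/cl -cE => h1 h2.
      rewrite (_ : K (m + z.1) - K (Y z.2) = (K (m + z.1) - q (cl (K (m + z.1)))) -
         (K (Y z.2) - q (cl (K (m + z.1)))))%R; last by rewrite opprB addrA subrK.
      by rewrite (le_trans (ler_normB _ _))// lerD// ltW.
  rewrite integral_cst//= probability_setT mule1 lee_fin /eta.
  have L10 : (0 < L + 1)%R by rewrite ltr_wpDl.
  rewrite (_ : L * _ = e * (L / (L + 1)))%R; last by field; rewrite gt_eqF.
  by rewrite -[leRHS]mulr1 ler_wpM2l ?(ltW e0)// ler_pdivrMr ?mul1r ?lerDl.
have law_snd (g : T -> \bar R) : measurable_fun [set: T] g ->
    (forall w, 0 <= g w) -> \int[M]_z g z.2 = \int[P]_w g w.
  move=> mg g0; rewrite -(ge0_integral_law M measurable_snd)//.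
  by apply: eq_measure_integral => B mB _; exact: M_snd.
have M_fst A : measurable A -> M [set z | A z.1] = mu A.
  move=> mA; rewrite -(mix_fst mu (cond_index P mf) mi mA).
  by congr (M _); apply/seteqP; split => z //= -[].
have law_fst (g : borel X -> \bar R) : measurable_fun [set: borel X] g ->
    (forall w, 0 <= g w) -> \int[M]_z g z.1 = \int[mu]_w g w.
  move=> mg g0; rewrite -(ge0_integral_law M measurable_fst)//.
  by apply: eq_measure_integral => B mB _; exact: M_fst.
pose S (z : borel X * T) : borel X := ((z.1 : X) + D z.2)%R.
have mD2 : measurable_fun [set: borel X * T] (fun z : borel X * T => D z.2).
  exact: (measurableT_comp mD measurable_snd).
have mY2 : measurable_fun [set: borel X * T] (fun z : borel X * T => Y z.2).
  exact: (measurableT_comp mY measurable_snd).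
have mS : measurable_fun [set: borel X * T] S.
  by apply: measurable_borelD => //; exact: measurable_fst.
have mnorm := measurable_borel_norm.
have D_lty : \int[P]_w (`|D w : X|)%:E < +oo.
  apply: (@le_lt_trans _ _ a%:E); last exact: ltry.
  by apply: (@mean_le_pnorm _ _ _ P p) => //; exact: mnorm.
have [b b0 mub] := moment_bound mu_Pp.
pose nu : probability (borel X) R := law M mS.
have nu_Pp : Pp p nu.
  rewrite /Pp/= /moment ge0_integral_law//; last first.
    by apply: measurable_EFin_powR; exact: mnorm borel_id_measurable.
  apply: (@le_lt_trans _ _ (((b + (a + 1)) `^ p)%R%:E)); last exact: ltry.
  apply: (@pnorm_triangle _ _ _ M p p_gt1 (fun z => `|z.1 : X|%R) (fun z => `|D z.2 : X|%R) (fun z => `|S z : X|%R)) => //.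
  - by rewrite ltr_wpDl.
  - exact: mnorm measurable_fst.
  - exact: mnorm.
  - exact: mnorm.
  - by move=> z; rewrite normr_ge0 ler_normD.
  - rewrite (law_fst (fun y : borel X => (`|y : X| `^ p)%R%:E))//.
    by apply: measurable_EFin_powR; exact: mnorm borel_id_measurable.
  - rewrite (law_snd (fun w => (`|D w : X| `^ p)%R%:E))//; last first.
      by apply: measurable_EFin_powR; exact: mnorm.
    rewrite (le_trans Da)// lee_fin ge0_ler_powR ?nnegrE ?(ltW p_gt0) ?addr_ge0//.
    by rewrite lerDl.
exists nu; split => //.
- have mpair : measurable_fun [set: borel X * T]
      ((fun z => (z.1, S z)) : _ -> borel X * borel X).
    by apply: measurable_fun_pair => //; exact: measurable_fst.
  have cpl : coupling mu nu (law M mpair).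
    move=> A mA; split.
      transitivity (M [set z | A z.1]); last exact: M_fst.
      by congr (M _); apply/seteqP; split => z //= -[].
    by congr (M _); apply/seteqP; split => z //= -[].
  rewrite /transport_cost; apply: ge_ereal_inf.
  exists (\int[law M mpair]_yz ((`|(yz.1 : X) - (yz.2 : X)| `^ p)%R)%:E).
    by exists (law M mpair).
  have mdist : measurable_fun [set: borel X * borel X]
      (fun yz : borel X * borel X => (`|(yz.1 : X) - (yz.2 : X)| `^ p)%R%:E).
    by apply: measurable_EFin_powR; apply: mnorm; apply: measurable_borelB.
  rewrite ge0_integral_law//.
  rewrite (eq_integral (fun z : borel X * T => (`|D z.2 : X| `^ p)%R%:E)); last first.
    by move=> z _ /=; rewrite /S opprD addrA subrr add0r normrN.
  rewrite (law_snd (fun w => (`|D w : X| `^ p)%R%:E))//.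
  by apply: measurable_EFin_powR; exact: mnorm.
- pose V (w : T) : borel X := ((Y w : X) + D w)%R.
  have mV : measurable_fun [set: T] V by exact: measurable_borelD.
  have mV2 : measurable_fun [set: borel X * T] (fun z : borel X * T => V z.2).
    exact: (measurableT_comp mV measurable_snd).
  have mu' := lip_measurable Kcontr uL.
  have iV : \int[P]_w (`|V w : X|)%:E < +oo by exact: norm_addr_lty.
  have iV2 : \int[M]_z (`|V z.2 : X|)%:E < +oo.
    by rewrite (law_snd (fun w => (`|V w : X|)%:E))//; exact/measurable_EFinP/mnorm.
  have V2_int := lip_integrable Kcontr uL mV2 iV2.
  have -> : \int[P]_w (u (V w))%:E = \int[M]_z (u (V z.2))%:E.
    have muV : measurable_fun [set: T] (fun w => (u (V w))%:E).
      by apply/measurable_EFinP; exact: (measurableT_comp mu' mV).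
    rewrite -(integral_law (P := M) measurable_snd muV)//.
    by apply: eq_measure_integral => B mB _; exact/esym/(M_snd _ mB).
  pose W (z : borel X * T) : borel X := (m + S z)%R.
  have mW : measurable_fun [set: borel X * T] W.
    exact: (measurableT_comp (measurable_borelDl m) mS).
  have iS : \int[M]_z (`|S z : X|)%:E < +oo.
    apply: norm_addr_lty => //.
      rewrite (law_fst (fun y : borel X => (`|y : X|)%R%:E))//; first exact: Pp_norm.
      by apply/measurable_EFinP; exact: mnorm borel_id_measurable.
    by rewrite (law_snd (fun w => (`|D w : X|)%R%:E))//; exact/measurable_EFinP/mnorm.
  have iW : \int[M]_z (`|W z : X|)%:E < +oo.
    apply: (@norm_addr_lty _ _ M (cst m) S) => //.
    rewrite (eq_integral (cst (`|m|%R)%:E))//.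
    by rewrite integral_cst//= probability_setT mule1 ltry.
  have W_int := lip_integrable Kcontr uL mW iW.
  have -> : \int[nu]_z (u (m + z)%R)%:E = \int[M]_z (u (W z))%:E.
    rewrite integral_law//.
    by apply/measurable_EFinP; exact: (measurableT_comp mu' (measurable_borelDl m)).
  apply: (@le_integral_add _ _ _ M (fun z => u (V z.2)) (fun z => u (W z)) _ e V2_int W_int _ _ _ M_close).
  + exact: mKdist.
  + by move=> z; rewrite mulr_ge0.
  + move=> z; rewrite -lerBlDl (le_trans (ler_norm _))//.
    case: uL => _ /(_ (V z.2) (W z))/le_trans; apply; rewrite ler_wpM2l//.
    rewrite [leRHS]distrC -raddfB le_eqVlt; apply/orP; left; apply/eqP.
    by congr (`|K _|%R); rewrite /V /W /S addrA opprD addrACA subrr addr0.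
Qed.
End displace_reference.

(** * Couplings and transport costs *)

Section integral_monotone.
Local Open Scope ereal_scope.

(** The integral of a nonnegative function is a supremum over the simple functions
    below it.  In this form the lemma compares the iterates of I, which are arbitrary
    extended-real functions. *)
Lemma integral_mono d (T : measurableType d) (R : realType)
    (mu : {measure set T -> \bar R}) (f g : T -> \bar R) :
  (forall x, f x <= g x) -> \int[mu]_x f x <= \int[mu]_x g x.
Proof.
move=> fg; rewrite [leLHS]integralE [leRHS]integralE.
have mono (f1 f2 : T -> \bar R) : (forall x, 0 <= f1 x) -> (forall x, 0 <= f2 x) ->
    (forall x, f1 x <= f2 x) -> \int[mu]_x f1 x <= \int[mu]_x f2 x.
  move=> f10 f20 f12; rewrite !ge0_integralTE//.
  by apply: ereal_sup_le => _ [h /= hf <-]; exists h => //= x; exact: le_trans (f12 x).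
apply: leeB; apply: mono => // x; rewrite ?funeposE ?funenegE.
  by rewrite ge_max !le_max fg lexx orbT.
by rewrite ge_max !le_max leeN2 fg lexx orbT.
Qed.

End integral_monotone.

Section couplings.
Local Open Scope ereal_scope.
Context {R : realType} {X : completeNormedModType R}.
Hypothesis Xsep : separable X.
Variable p : R.
Hypothesis p_gt1 : (1 < p)%R.
Implicit Types mu nu : probability (borel X) R.

Let p_gt0 : (0 < p)%R. Proof. exact: lt_trans p_gt1. Qed.

Let powRVK (v : R) : (0 <= v -> (v `^ p^-1) `^ p = v)%R.
Proof. by move=> v0; rewrite -powRrM mulVf ?gt_eqF// powRr1. Qed.

Lemma measurable_dist : measurable_fun [set: borel X * borel X]
  (fun yz : borel X * borel X => `|(yz.1 : X) - (yz.2 : X)|%R).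
Proof.
by apply: measurable_borel_norm; apply: measurable_borelB.
Qed.

Lemma transport_cost_ge0 mu nu : 0 <= transport_cost p mu nu.
Proof.
apply: le_ereal_inf_tmp => _ [pi _ <-]; apply: integral_ge0 => z _.
by rewrite lee_fin powR_ge0.
Qed.

Lemma wasserstein_ge0 mu nu : (0 <= wasserstein p mu nu)%R.
Proof. exact: powR_ge0. Qed.

Section coupling_marginals.
Context mu nu (pi : probability (borel X * borel X)%type R).
Hypothesis cpl : coupling mu nu pi.

Lemma ge0_integral_fst (g : borel X -> \bar R) : measurable_fun [set: borel X] g ->
  (forall y, 0 <= g y) -> \int[pi]_z g z.1 = \int[mu]_y g y.
Proof.
move=> mg g0; rewrite -(ge0_integral_law pi measurable_fst)//.
apply: eq_measure_integral => A mA _; apply: etrans (cpl mA).1.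
by congr (pi _); apply/seteqP; split => z //= -[].
Qed.

Lemma ge0_integral_snd (g : borel X -> \bar R) : measurable_fun [set: borel X] g ->
  (forall y, 0 <= g y) -> \int[pi]_z g z.2 = \int[nu]_y g y.
Proof.
move=> mg g0; rewrite -(ge0_integral_law pi measurable_snd)//.
apply: eq_measure_integral => A mA _; apply: etrans (cpl mA).2.
by congr (pi _); apply/seteqP; split => z //= -[].
Qed.

Lemma integrable_fst (g : borel X -> \bar R) : mu.-integrable setT g ->
  pi.-integrable setT (fun z => g z.1).
Proof.
move=> /integrableP[mg ig]; apply/integrableP; split.
  exact: (measurableT_comp mg measurable_fst).
rewrite (ge0_integral_fst (g := fun y => `|g y|))//.
exact: measurableT_comp.
Qed.

Lemma integrable_snd (g : borel X -> \bar R) : nu.-integrable setT g ->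
  pi.-integrable setT (fun z => g z.2).
Proof.
move=> /integrableP[mg ig]; apply/integrableP; split.
  exact: (measurableT_comp mg measurable_snd).
rewrite (ge0_integral_snd (g := fun y => `|g y|))//.
exact: measurableT_comp.
Qed.

Lemma integral_fst (g : borel X -> \bar R) : mu.-integrable setT g ->
  \int[pi]_z g z.1 = \int[mu]_y g y.
Proof.
move=> ig; have /integrableP[mg _] := ig.
rewrite -(integral_law (P := pi) measurable_fst mg); last exact: integrable_fst.
apply: eq_measure_integral => A mA _; apply: etrans (cpl mA).1.
by congr (pi _); apply/seteqP; split => z //= -[].
Qed.

Lemma integral_snd (g : borel X -> \bar R) : nu.-integrable setT g ->
  \int[pi]_z g z.2 = \int[nu]_y g y.
Proof.
move=> ig; have /integrableP[mg _] := ig.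
rewrite -(integral_law (P := pi) measurable_snd mg); last exact: integrable_snd.
apply: eq_measure_integral => A mA _; apply: etrans (cpl mA).2.
by congr (pi _); apply/seteqP; split => z //= -[].
Qed.

End coupling_marginals.

(** The independent coupling has finite cost, by Minkowski's inequality. *)
Lemma transport_cost_lty mu nu : Pp p mu -> Pp p nu ->
  transport_cost p mu nu < +oo.
Proof.
move=> mup nup; have [a a0 mua] := moment_bound p_gt1 mup.
have [b b0 nub] := moment_bound p_gt1 nup.
pose pi : probability (borel X * borel X)%type R :=
  mix mu (fun=> nu) (@measurable_cst _ _ (borel X) nat setT 0%N).
have cpl : coupling mu nu pi.
  move=> A mA; split; first exact: mix_fst.
  transitivity (\int[mu]_y cst (nu A) y); last first.
    by rewrite integral_cst//= probability_setT mule1.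
  apply: eq_integral => y _; congr (nu _).
  by apply/seteqP; split => z //= -[].
apply: (@le_lt_trans _ _ ((a + b) `^ p)%:E); last exact: ltry.
rewrite /transport_cost; apply: ge_ereal_inf.
exists (\int[pi]_yz ((`|(yz.1 : X) - (yz.2 : X)| `^ p)%R)%:E); first by exists pi.
have mid := borel_id_measurable (R := R) (X := X).
apply: (@pnorm_triangle _ _ _ pi p p_gt1 (fun z => `|z.1 : X|%R)
  (fun z => `|z.2 : X|%R) (fun z => `|(z.1 : X) - (z.2 : X)|%R)) => //.
- exact: measurable_borel_norm measurable_fst.
- exact: measurable_borel_norm measurable_snd.
- exact: measurable_dist.
- by move=> z; rewrite normr_ge0 ler_normB.
- rewrite (ge0_integral_fst cpl (g := fun y : borel X => (`|y : X| `^ p)%R%:E))//.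
  by apply: measurable_EFin_powR; exact: measurable_borel_norm.
- rewrite (ge0_integral_snd cpl (g := fun y : borel X => (`|y : X| `^ p)%R%:E))//.
  by apply: measurable_EFin_powR; exact: measurable_borel_norm.
Qed.

Lemma transport_costE mu nu : Pp p mu -> Pp p nu ->
  transport_cost p mu nu = (wasserstein p mu nu `^ p)%:E.
Proof.
move=> mup nup; rewrite /wasserstein powRVK; last first.
  by rewrite fine_ge0// transport_cost_ge0.
by rewrite fineK// ge0_fin_numE ?transport_cost_ge0// transport_cost_lty.
Qed.

Lemma near_optimal_coupling mu nu (r : R) : Pp p mu -> Pp p nu ->
  (wasserstein p mu nu `^ p < r)%R ->
  exists2 pi : probability (borel X * borel X)%type R, coupling mu nu pi &
    \int[pi]_yz ((`|(yz.1 : X) - (yz.2 : X)| `^ p)%R)%:E <= r%:E.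
Proof.
move=> mup nup; rewrite -lte_fin -transport_costE// => /ereal_inf_lt.
by move=> [_ [pi cpl <-] /ltW]; exists pi.
Qed.

Lemma wasserstein_le mu nu (a : R) : Pp p mu -> Pp p nu -> (0 <= a)%R ->
  transport_cost p mu nu <= (a `^ p)%:E -> (wasserstein p mu nu <= a)%R.
Proof.
move=> mup nup a0; rewrite transport_costE// lee_fin => h.
rewrite leNgt; apply/negP => aW; move: h; rewrite leNgt => /negP; apply.
by apply: gt0_ltr_powR => //; rewrite nnegrE// wasserstein_ge0.
Qed.

Definition diagonal mu : probability (borel X * borel X)%type R :=
  law mu (measurable_fun_pair (@measurable_id _ (borel X) setT)
                              (@measurable_id _ (borel X) setT)).

Lemma diagonal_coupling mu : coupling mu mu (diagonal mu).
Proof.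
by move=> A mA; split; congr (mu _); apply/seteqP; split => z //= -[].
Qed.

Lemma diagonal_cost mu :
  \int[diagonal mu]_yz ((`|(yz.1 : X) - (yz.2 : X)| `^ p)%R)%:E = 0.
Proof.
rewrite ge0_integral_law//=.
- by apply: integral0_eq => y _; rewrite subrr normr0 powR0// gt_eqF.
- by apply: measurable_EFin_powR; exact: measurable_dist.
Qed.

Lemma wasserstein_diag mu : wasserstein p mu mu = 0%R.
Proof.
have c0 : transport_cost p mu mu = 0.
  apply/eqP; rewrite eq_le transport_cost_ge0 andbT -(diagonal_cost mu).
  by apply: ereal_inf_lbound; exists (diagonal mu) => //; exact: diagonal_coupling.
by rewrite /wasserstein c0 powR0// invr_eq0 gt_eqF.
Qed.

End couplings.

(** * Clipping *)

Section clipping.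
Context {R : realType}.

Definition clip (n : nat) (v : R) : R := Num.max (- n%:R) (Num.min v n%:R).

Lemma clipE n v :
  clip n v = if v < - n%:R then - n%:R else if n%:R < v then n%:R else v.
Proof.
have n0 : 0 <= n%:R :> R by [].
rewrite /clip; case: ifPn => [?|]; last rewrite -leNgt => ?.
  by rewrite min_l ?max_l; lra.
case: ifPn => [?|]; first by rewrite min_r ?max_r; lra.
by rewrite -leNgt => ?; rewrite min_l ?max_r.
Qed.

Lemma clip_dist n v w : `|clip n v - clip n w| <= `|v - w|.
Proof.
have n0 : 0 <= n%:R :> R by [].
have vw := ler_norm (v - w); have := ler_norm (w - v); rewrite distrC => wv.
rewrite !clipE ler_norml.
repeat (case: ifPn; rewrite -?leNgt => ?); lra.
Qed.

Lemma clip_norm n v : `|clip n v| <= n%:R.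
Proof.
have n0 : 0 <= n%:R :> R by [].
rewrite !clipE ler_norml.
repeat (case: ifPn; rewrite -?leNgt => ?); lra.
Qed.

Lemma clip_le n v : `|clip n v| <= `|v|.
Proof.
have := clip_dist n v 0; rewrite subr0.
by rewrite {2}/clip (_ : Num.max _ _ = 0) ?subr0// min_l// max_r// oppr_le0.
Qed.

Lemma clip_id n v : `|v| <= n%:R -> clip n v = v.
Proof. by rewrite ler_norml => /andP[? ?]; rewrite /clip min_l// max_r. Qed.

End clipping.

(** * Integrating functions of a countable index *)

Section index_integrals.
Local Open Scope ereal_scope.
Context d {T : measurableType d} {R : realType} (P : probability T R).
Variable f : T -> nat.
Hypothesis mf : measurable_fun [set: T] f.

Let mF (A : set nat) : measurable (f @^-1` A).
Proof. by rewrite -[X in measurable X]setTI; exact: mf. Qed.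

Definition weight (i : nat) : R := fine (P (f @^-1` [set i])).

Lemma weight_ge0 i : (0 <= weight i)%R.
Proof. exact: fine_ge0. Qed.

Lemma integral_index (N : nat) (h : nat -> R) : (forall i, 0 <= h i)%R ->
  (forall i, (N <= i)%N -> h i = 0%R) ->
  \int[P]_x (h (f x))%:E = (\sum_(i < N) weight i * h i)%:E.
Proof.
move=> h0 hN.
transitivity (\int[P]_x (\sum_(i < N) (h i)%:E * (\1_(f @^-1` [set (i : nat)]) x)%:E)).
  apply: eq_integral => x _; have [fN|fN] := ltnP (f x) N.
    rewrite (bigD1 (Ordinal fN))//= indicE mem_set// mule1 big1 ?adde0// => i iN.
    rewrite indicE memNset ?mule0//= => fi; move/eqP: iN; apply.
    exact/val_inj.
  rewrite hN// big1// => i _; rewrite indicE memNset ?mule0//= => fi.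
  by move: fN; rewrite fi leqNgt ltn_ord.
rewrite ge0_integral_sum//; last 2 first.
  by move=> i; apply: measurable_funeM; exact/measurable_EFinP/measurable_indic.
  by move=> i x _; rewrite -EFinM lee_fin mulr_ge0.
rewrite -sumEFin; apply: eq_bigr => i _.
rewrite ge0_integralZl ?lee_fin//; last by exact/measurable_EFinP/measurable_indic.
rewrite integral_indic// setIT EFinM muleC fineK//.
exact: fin_num_measure.
Qed.

Lemma sum_weight_le1 N : (\sum_(i < N) weight i <= 1)%R.
Proof.
rewrite -lee_fin.
have -> : (\sum_(i < N) weight i = \sum_(i < N) weight i * (i < N)%:R)%R.
  by apply: eq_bigr => i _; rewrite ltn_ord mulr1.
rewrite -(@integral_index N (fun i => (i < N)%:R)%R)//; last first.
  by move=> i; rewrite leqNgt => /negbTE->.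
rewrite (@le_trans _ _ (\int[P]_x cst 1 x))//.
  by apply: integral_mono => x; rewrite lee_fin lern1 leq_b1.
by rewrite integral_cst//= mul1e probability_setT.
Qed.

(** The events N <= f decrease to the empty set. *)
Lemma index_tail (C e : R) : (0 <= C)%R -> (0 < e)%R ->
  exists N, \int[P]_x (C * (N <= f x)%N%:R)%:E <= e%:E.
Proof.
move=> C0 e0.
pose F N := f @^-1` [set i | (N <= i)%N].
have F0 : \bigcap_n F n = set0.
  by apply/seteqP; split => // x /(_ (f x).+1 I); rewrite /F /= ltnn.
have cvgF : (P \o F) n @[n --> \oo] --> 0.
  rewrite -(measure0 P) -F0; apply: nonincreasing_cvg_mu.
  - by rewrite (le_lt_trans (probability_le1 _ _)) ?ltry//; exact: mF.
  - by move=> n; exact: mF.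
  - by rewrite F0.
  - by move=> m n mn; apply/subsetPset => x; exact: leq_trans.
have [_ /cvgrPdist_lt cvgF'] := (fine_cvgP _ _).1 cvgF.
have eC : (0 < e / (C + 1))%R by rewrite divr_gt0// ltr_wpDl.
have [N _ /(_ N (leqnn N))] := cvgF' _ eC.
rewrite /= sub0r normrN ger0_norm ?fine_ge0// => FN.
exists N.
rewrite (eq_integral (fun x => C%:E * (\1_(F N) x)%:E)); last first.
  move=> x _; rewrite EFinM indicE; have [Nx|Nx] := boolP (N <= f x)%N.
    by rewrite mem_set.
  by rewrite memNset//; exact/negP.
rewrite ge0_integralZl ?lee_fin//; last by exact/measurable_EFinP/measurable_indic/mF.
rewrite integral_indic ?setIT//; last exact: mF.
have fin : P (F N) \is a fin_num by apply: fin_num_measure; exact: mF.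
apply: (@le_trans _ _ (C%:E * (fine (P (F N)))%:E)); first by rewrite fineK.
rewrite -EFinM lee_fin (@le_trans _ _ (C * (e / (C + 1)))%R)//.
  by rewrite ler_wpM2l// ltW.
by rewrite mulrCA -[leRHS]mulr1 ler_wpM2l ?(ltW e0)// ler_pdivrMr ?ltr_wpDl// mul1r lerDl.
Qed.

End index_integrals.

(** * Bounded Lipschitz functions determine the law of K Y *)

Section law_of_image.
Local Open Scope ereal_scope.
Context {R : realType} {X : completeNormedModType R}.
Variable K : {linear X -> X}.
Hypothesis Kcontr : forall x : X, (`|K x| <= `|x|)%R.

Definition dist_to (A : set X) (x : X) : R := inf [set `|x - a|%R | a in A].

Section dist_to.
Variable A : set X.
Hypothesis A0 : A !=set0.

Let hasinf x : has_inf [set `|x - a|%R | a in A].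
Proof.
split; first by case: A0 => a Aa; exists `|x - a|%R; exists a.
by exists 0%R => _ [a _ <-].
Qed.

Lemma dist_to_ge0 x : (0 <= dist_to A x)%R.
Proof. by apply: lb_le_inf; [exact: (hasinf x).1|move=> _ [a _ <-]]. Qed.

Lemma dist_to_le x a : A a -> (dist_to A x <= `|x - a|)%R.
Proof. by move=> Aa; apply: ge_inf; [exact: (hasinf x).2|exists a]. Qed.

Lemma dist_to_lip x y : (dist_to A x <= dist_to A y + `|x - y|)%R.
Proof.
rewrite -lerBlDr; apply: lb_le_inf; first exact: (hasinf y).1.
move=> _ [a Aa <-]; rewrite lerBlDr (le_trans (dist_to_le x Aa))//.
rewrite (_ : x - a = (x - y) + (y - a))%R; last by rewrite addrA subrK.
by rewrite [leRHS]addrC ler_normD.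
Qed.

Lemma dist_to_gt0 x : open (~` A) -> ~ A x -> (0 < dist_to A x)%R.
Proof.
move=> oA Ax; have /nbhs_ballP[e /= e0 eA] : nbhs x (~` A).
  exact: open_nbhs_nbhs.
apply: (lt_le_trans e0); apply: lb_le_inf; first exact: (hasinf x).1.
move=> _ [a Aa <-]; rewrite leNgt; apply/negP => xa.
by apply: (eA a) => //; rewrite -ball_normE.
Qed.

End dist_to.

(** For closed A, these functions increase to the indicator of the open set of all x
    with K x outside A. *)
Definition bump (A : set X) (n : nat) (x : X) : R :=
  Num.min 1%R (n%:R * dist_to A (K x))%R.

Lemma bump_ge0 A n x : A !=set0 -> (0 <= bump A n x)%R.
Proof. by move=> A0; rewrite le_min ler01 mulr_ge0// dist_to_ge0. Qed.

Lemma bump_le1 A n x : (bump A n x <= 1)%R.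
Proof. by rewrite ge_min lexx. Qed.

Lemma bump_lip A n : A !=set0 -> lip_bound K (bump A n) n%:R.
Proof.
move=> A0; split => // x y.
have aux x' y' : (bump A n x' <= bump A n y' + n%:R * `|K (x' - y')|)%R.
  have h : (n%:R * dist_to A (K x') <=
      n%:R * dist_to A (K y') + n%:R * `|K (x' - y')|)%R.
    by rewrite -mulrDr ler_wpM2l// raddfB; exact: dist_to_lip.
  rewrite [X in (_ <= X + _)%R]/bump; case: (leP 1%R (n%:R * dist_to A (K y'))%R) => _.
    by rewrite (le_trans (bump_le1 _ _ _))// lerDl mulr_ge0.
  by rewrite (le_trans _ h)// /bump ge_min lexx orbT.
rewrite ler_norml; apply/andP; split; last by rewrite lerBlDl.
by rewrite lerNl opprB lerBlDl -normrN -raddfN opprB.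
Qed.

Lemma bump_Lipb A n : A !=set0 -> Lipb K (bump A n).
Proof.
move=> A0; split; first by exists n%:R; exact: bump_lip.
apply: (@le_lt_trans _ _ 1); last exact: ltry.
apply: ge_ereal_sup => _ [x _ <-]; rewrite lee_fin ger0_norm ?bump_ge0//.
exact: bump_le1.
Qed.

(** The constant sequence converges. *)
Lemma Lipb_Cb (f : X -> R) : Lipb K f -> Cb K f.
Proof.
move=> fb; exists (fun=> f); split => //; split.
  by apply: le_lt_trans fb.2; apply: ge_ereal_sup => _ [_ _ <-].
move=> r r0; rewrite [X in X @ _ --> _](_ : _ = cst 0); first exact: cvg_cst.
apply/funext => _ /=; apply/eqP; rewrite eq_le; apply/andP; split.
  by apply: ge_ereal_sup => _ [y _ <-]; rewrite subrr normr0.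
by apply: ereal_sup_ubound; exists 0%R => /=; rewrite ?normr0 ?subrr ?normr0.
Qed.

Lemma bump_cvg d (T : measurableType d) (P : probability T R) (Y : T -> borel X)
    (A : set X) : A !=set0 -> open (~` A) -> measurable_fun [set: T] Y ->
  \int[P]_w (bump A n (Y w))%:E @[n --> \oo] --> P [set w | ~ A (K (Y w))].
Proof.
move=> A0 oA mY.
have mKY : measurable_fun [set: T] ((fun w => K (Y w)) : T -> borel X).
  by apply: measurableT_comp mY; apply: continuous_borel; exact: K_continuous.
have mB : measurable [set w | ~ A (K (Y w))].
  rewrite -[X in measurable X]setTI; apply: (mKY measurableT (~` A)).
  exact: sub_sigma_algebra.
have [|||||_ _ h] := @dominated_convergence _ _ _ P setT measurableT
  (fun n w => (bump A n (Y w))%:E)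
  (fun w => (\1_[set w | ~ A (K (Y w))] w)%:E) (cst 1).
- move=> n; apply/measurable_EFinP.
  exact: (measurableT_comp (lip_measurable Kcontr (bump_lip n A0)) mY).
- exact/measurable_EFinP/measurable_indic.
- apply/aeW => w _; apply: cvg_near_cst.
  have [Aw|Aw] := pselect (A (K (Y w))).
    near=> n; rewrite indicE memNset//=.
    congr EFin; apply/eqP; rewrite eq_le bump_ge0// andbT.
    rewrite /bump ge_min; apply/orP; right.
    have -> : dist_to A (K (Y w)) = 0%R.
      apply/eqP; rewrite eq_le dist_to_ge0// andbT.
      by have := dist_to_le A0 (K (Y w)) Aw; rewrite subrr normr0.
    by rewrite mulr0.
  near=> n; rewrite indicE mem_set//=; congr EFin.
  rewrite /bump min_l// -ler_pdivrMr; last exact: dist_to_gt0.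
  by near: n; exact: nbhs_infty_ger.
- exact: finite_measure_integrable_cst.
- apply/aeW => w n _ /=; rewrite lee_fin ger0_norm ?bump_ge0//; exact: bump_le1.
by rewrite integral_indic// setIT in h.
Unshelve. all: end_near. Qed.

(** Functions that are Lipschitz in K x see only K x, whence K on both sides.  Open
    sets are a generating pi-system, and their indicators are limits of [bump]. *)
Lemma eq_law_K d d' (T : measurableType d) (T' : measurableType d')
    (P : probability T R) (P' : probability T' R)
    (Y : T -> borel X) (Y' : T' -> borel X) :
  measurable_fun [set: T] Y -> measurable_fun [set: T'] Y' ->
  (forall f : X -> R, (forall x, 0 <= f x)%R -> Lipb K f ->
    \int[P]_w (f (Y w))%:E = \int[P']_w (f (Y' w))%:E) ->
  forall B : set X, measurable (B : set (borel X)) ->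
    P [set w | B (K (Y w))] = P' [set w | B (K (Y' w))].
Proof.
move=> mY mY' eqf B mB.
have mK : measurable_fun [set: borel X] (K : borel X -> borel X).
  by apply: continuous_borel; exact: K_continuous.
have mKY := measurableT_comp mK mY; have mKY' := measurableT_comp mK mY'.
have openP U : open U -> law P mKY U = law P' mKY' U.
  move=> oU; have [AU|/set0P AU] := eqVneq (~` U) set0.
    have -> : U = setT by rewrite -[U]setCK AU setC0.
    by rewrite !probability_setT.
  have oCU : open (~` ~` U) by rewrite setCK.
  have h1 := bump_cvg (P := P) AU oCU mY.
  have h2 := bump_cvg (P := P') AU oCU mY'.
  have eqn : (fun n => \int[P]_w (bump (~` U) n (Y w))%:E) =
             (fun n => \int[P']_w (bump (~` U) n (Y' w))%:E).
    apply/funext => n; apply: eqf; last exact: bump_Lipb.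
    by move=> x; exact: bump_ge0.
  rewrite eqn in h1.
  have UE d0 (T0 : measurableType d0) (Q : probability T0 R) (V : T0 -> X) :
      Q [set w | ~ (~` U) (K (V w))] = Q [set w | U (K (V w))].
    by congr (Q _); apply/seteqP; split => w /= => [/contrapT|Uw /(_ Uw)].
  rewrite !UE in h1 h2.
  transitivity (P [set w | U (K (Y w))]) => //.
  by rewrite -(cvg_lim _ h1)// (cvg_lim _ h2).
have := @measure_unique _ R (borel X) (@open X) (fun=> setT) erefl _ _ _
  (law P mKY) (law P' mKY') openP _ B mB.
apply.
- by move=> A C; exact: openI.
- by move=> _; exact: openT.
- by apply/seteqP; split => // x _; exists 0%N.
- by move=> _; apply: le_lt_trans (probability_le1 _ _) _; rewrite ?ltry.
Qed.

End law_of_image.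

(** * The operators T and I on Lipschitz functions *)

Section operator_theory.
Local Open Scope ereal_scope.
Context {R : realType} {X : completeNormedModType R}.
Hypothesis Xsep : separable X.
Variable K : {linear X -> X}.
Hypothesis Kcontr : forall x : X, (`|K x| <= `|x|)%R.
Variable p : R.
Hypothesis p_gt1 : (1 < p)%R.

Lemma shift_norm_lty (nu : probability (borel X) R) (m : X) : Pp p nu ->
  \int[nu]_z (`|m + (z : X)|%R)%:E < +oo.
Proof.
move=> nup; apply: (@norm_addr_lty _ _ Xsep _ _ nu (cst m) id) => //.
  rewrite (eq_integral (cst (`|m|%R)%:E))//.
  by rewrite integral_cst//= probability_setT mule1 ltry.
exact: Pp_norm nup.
Qed.

Lemma shift_integrable (u : X -> R) (L : R) (nu : probability (borel X) R) (m : X) :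
  lip_bound K u L -> Pp p nu ->
  nu.-integrable setT (EFin \o (fun z : borel X => u (m + (z : X))%R)).
Proof.
move=> uL nup; apply: (lip_integrable Kcontr uL) => //.
  exact: measurable_borelDl.
exact: shift_norm_lty.
Qed.

(** The infimum defining the Lipschitz constant is attained. *)
Lemma lip_norm_bound (u : X -> R) : Lip K u -> lip_bound K u (lip_norm K u).
Proof.
move=> [L uL]; have Lset : [set L | lip_bound K u L] !=set0 by exists L.
split; first by apply: lb_le_inf => // r [].
move=> x1 x2; have [K0|Kn0] := eqVneq (`|K (x1 - x2)|)%R 0%R.
  by rewrite K0 mulr0; case: uL => _ /(_ x1 x2); rewrite K0 mulr0.
have {}Kn0 : (0 < `|K (x1 - x2)|)%R by rewrite lt_neqAle eq_sym Kn0/=.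
rewrite -ler_pdivrMr//; apply: lb_le_inf => // r [_ /(_ x1 x2)].
by rewrite ler_pdivrMr.
Qed.

(** An almost optimal coupling moves points by at most W + delta on average, since the
    mean is dominated by the p-norm. *)
Lemma transport_lip (u : X -> R) (L : R) (mu nu : probability (borel X) R) (m : X) :
  lip_bound K u L -> Pp p mu -> Pp p nu ->
  \int[nu]_z (u (m + (z : X))%R)%:E <=
  \int[mu]_z (u (m + (z : X))%R)%:E + (L * wasserstein p mu nu)%:E.
Proof.
move=> uL mup nup; have L0 : (0 <= L)%R by case: uL.
set W := wasserstein p mu nu; have W0 : (0 <= W)%R by exact: wasserstein_ge0.
apply/lee_addgt0Pr => e e0; rewrite -addeA -EFinD.
pose delta := (e / (L + 1))%R.
have L1 : (0 < L + 1)%R by rewrite ltr_wpDl.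
have delta0 : (0 < delta)%R by rewrite divr_gt0.
have [|pi cpl pic] := @near_optimal_coupling _ _ Xsep p p_gt1 mu nu ((W + delta) `^ p)%R mup nup.
  rewrite gt0_ltr_powR ?(lt_trans _ p_gt1)// ?nnegrE ?addr_ge0 ?(ltW delta0)//.
  by rewrite ltrDl.
have imu := shift_integrable m uL mup; have inu := shift_integrable m uL nup.
rewrite -(integral_snd cpl inu) -(integral_fst cpl imu).
apply: (@le_integral_add _ _ _ pi _ _ (fun z => L * `|(z.1 : X) - (z.2 : X)|)%R).
- exact: (integrable_snd cpl inu).
- exact: (integrable_fst cpl imu).
- by apply: measurable_funM => //; exact: measurable_dist.
- by move=> z; rewrite mulr_ge0.
- move=> z; rewrite (le_trans (lip_le Kcontr uL _ (m + z.1)%R))// lerD2l distrC.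
  by rewrite opprD addrACA subrr add0r.
under eq_integral do rewrite EFinM.
rewrite ge0_integralZl//; last by apply/measurable_EFinP; exact: measurable_dist.
apply: (@le_trans _ _ (L%:E * (W + delta)%:E)).
  rewrite lee_wpmul2l//; apply: (@mean_le_pnorm _ _ _ pi p p_gt1) => //.
    by rewrite addr_ge0// ltW.
  exact: measurable_dist.
rewrite -EFinM lee_fin mulrDr lerD2l /delta.
by rewrite mulrCA -[leRHS]mulr1 ler_wpM2l ?(ltW e0)// ler_pdivrMr ?mul1r ?lerDl.
Qed.

Variables (c : R) (phi : R -> \bar R).
Hypothesis c_ge0 : (0 <= c)%R.
Hypothesis phi_pen : penalisation p phi.
Variables (mu : R -> probability (borel X) R) (psi : R -> X -> X).
Hypothesis mu_Pp : forall t : R, (0 <= t)%R -> Pp p (mu t).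
Hypothesis psi_cont : forall t : R, (0 <= t)%R -> continuous (psi t).
Hypothesis psi_lip : forall (t : R) (x1 x2 : X), (0 <= t)%R ->
  (`|psi t x1 - psi t x2| <= expR (c * t) * `|x1 - x2|)%R.
Hypothesis K_psi : forall (t : R) (x : X), (0 <= t)%R -> K (psi t x) = psi t (K x).
Hypothesis mu_psi : forall (s t : R) (u : X -> R) (x : X),
  (0 <= s)%R -> (0 <= t)%R -> Cb K u ->
  \int[mu (t + s)%R]_y (u (psi (t + s)%R x + y)%R)%:E =
  \int[mu t]_yt \int[mu s]_ys (u (psi s (psi t x + yt) + ys)%R)%:E.

Local Notation T := (opT mu psi).
Local Notation I := (opI p c phi mu psi).

Let p_gt0 : (0 < p)%R. Proof. exact: lt_trans p_gt1. Qed.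

Lemma opI_mono t (u v : X -> \bar R) x : (forall y, u y <= v y) -> I t u x <= I t v x.
Proof.
move=> uv; apply: ge_ereal_sup => _ [nu nup <-].
apply: le_ereal_sup_tmp.
exists (\int[nu]_z v (psi t x + (z : X))%R - scaled c phi t (wasserstein p (mu t) nu)).
  by exists nu.
by rewrite leeD2r//; apply: integral_mono => y.
Qed.

Lemma opT_le_opI t (u : X -> \bar R) x : (0 <= t)%R -> T t u x <= I t u x.
Proof.
move=> t0; apply: ereal_sup_ubound; exists (mu t); first exact: mu_Pp.
by rewrite wasserstein_diag// (scaled0 _ phi_pen) sube0.
Qed.

Section lipschitz_argument.
Variables (u : X -> R) (L t : R).
Hypothesis uL : lip_bound K u L.
Hypothesis t0 : (0 <= t)%R.

Let L0 : (0 <= L)%R. Proof. by case: uL. Qed.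

Lemma opT_fin x : T t (EFin \o u) x \is a fin_num.
Proof. by apply: integrable_fin_num => //; exact: shift_integrable uL (mu_Pp t0). Qed.

Lemma opI_le_opT x :
  I t (EFin \o u) x <= T t (EFin \o u) x + t%:E * conjugate phi (expR (c * t) * L)%R.
Proof.
apply: ge_ereal_sup => _ [nu nup <-].
apply: (@le_trans _ _ (T t (EFin \o u) x + (L * wasserstein p (mu t) nu)%:E -
    scaled c phi t (wasserstein p (mu t) nu))).
  by rewrite leeD2r//; exact: (transport_lip _ uL (mu_Pp t0) nup).
rewrite -addeA leeD2l//; apply: fenchel => //.
exact: wasserstein_ge0.
Qed.

Lemma opI_fin x : I t (EFin \o u) x \is a fin_num.
Proof.
rewrite fin_numE; apply/andP; split.
  rewrite gt_eqF// (lt_le_trans _ (opT_le_opI _ _ t0))//.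
  by rewrite ltNye; have := opT_fin x; rewrite fin_numE => /andP[].
rewrite lt_eqF// (le_lt_trans (opI_le_opT x))//.
rewrite lte_add_pinfty//.
  by rewrite ltey; have := opT_fin x; rewrite fin_numE => /andP[].
have e0 : (0 <= expR (c * t) * L)%R by rewrite mulr_ge0 ?expR_ge0.
have := conjugate_lty p_gt1 phi_pen e0; have := conjugate_ge0 phi_pen (expR (c * t) * L)%R.
by case: (conjugate _ _) => // r _ _; rewrite -EFinM ltry.
Qed.

(** The map psi_t commutes with K, so it is also e^(ct)-Lipschitz for the seminorm
    |K x|. *)
Lemma shift_lip (nu : probability (borel X) R) x1 x2 : Pp p nu ->
  \int[nu]_z (u (psi t x1 + (z : X))%R)%:E <=
  \int[nu]_z (u (psi t x2 + (z : X))%R)%:E + (L * expR (c * t) * `|K (x1 - x2)|)%:E.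
Proof.
move=> nup; have i1 := shift_integrable (psi t x1) uL nup.
have i2 := shift_integrable (psi t x2) uL nup.
apply: (@le_integral_add _ _ _ nu _ _ (cst (L * expR (c * t) * `|K (x1 - x2)|)%R)) => //.
- by move=> z; rewrite mulr_ge0// mulr_ge0// expR_ge0.
- move=> z; rewrite -lerBlDl (le_trans (ler_norm _))//.
  case: uL => _ /(_ (psi t x1 + (z : X)) (psi t x2 + (z : X)))%R/le_trans; apply.
  rewrite -mulrA ler_wpM2l//= opprD addrACA subrr addr0.
  by rewrite !raddfB/= !K_psi// psi_lip.
- rewrite (eq_integral (cst (L * expR (c * t) * `|K (x1 - x2)|)%:E))//.
  by rewrite integral_cst//= probability_setT mule1.
Qed.

Let lip_of_le (f : X -> R) C : (0 <= C)%R ->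
  (forall x1 x2, f x1 <= f x2 + C * `|K (x1 - x2)|)%R -> lip_bound K f C.
Proof.
move=> C0 fC; split => // x1 x2; rewrite ler_norml; apply/andP; split.
  by rewrite lerNl opprB lerBlDl -normrN -raddfN opprB.
by rewrite lerBlDl.
Qed.

Lemma opT_lip : lip_bound K (fine \o T t (EFin \o u)) (L * expR (c * t)).
Proof.
apply: lip_of_le => [|x1 x2]; first by rewrite mulr_ge0 ?expR_ge0.
rewrite -lee_fin EFinD /= !fineK ?opT_fin//; exact: shift_lip (mu_Pp t0).
Qed.

Lemma opI_lip : lip_bound K (fine \o I t (EFin \o u)) (L * expR (c * t)).
Proof.
apply: lip_of_le => [|x1 x2]; first by rewrite mulr_ge0 ?expR_ge0.
rewrite -lee_fin EFinD /= !fineK ?opI_fin//; apply: ge_ereal_sup => _ [nu nup <-].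
apply: (le_trans (leeD2r _ (shift_lip x1 x2 nup))).
rewrite addeAC leeD2r//; apply: ereal_sup_ubound; by exists nu.
Qed.

Lemma opTE : T t (EFin \o u) = EFin \o (fine \o T t (EFin \o u)).
Proof. by apply/funext => x /=; rewrite fineK ?opT_fin. Qed.

Lemma opIE : I t (EFin \o u) = EFin \o (fine \o I t (EFin \o u)).
Proof. by apply/funext => x /=; rewrite fineK ?opI_fin. Qed.

Lemma clip_lip n : lip_bound K (clip n \o u) L.
Proof.
split => // x1 x2; rewrite (le_trans (clip_dist _ _ _))//.
by case: uL => _; exact.
Qed.

Lemma norm_lip : lip_bound K (fun x => `|u x|)%R L.
Proof.
split => // x1 x2; rewrite (le_trans (ler_dist_dist _ _))//.
by case: uL => _; exact.
Qed.

Lemma opT_clip_cvg x :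
  T t (EFin \o (clip n \o u)) x @[n --> \oo] --> T t (EFin \o u) x.
Proof.
have iu := shift_integrable (psi t x) uL (mu_Pp t0).
have iabs := shift_integrable (psi t x) norm_lip (mu_Pp t0).
have itr n := shift_integrable (psi t x) (clip_lip n) (mu_Pp t0).
have [|||||_ _ h] := @dominated_convergence _ _ _ (mu t) setT measurableT
  (fun n y => (clip n (u (psi t x + (y : X))%R))%:E)
  (fun y => (u (psi t x + (y : X))%R)%:E)
  (fun y => (`|u (psi t x + (y : X))%R|%R)%:E).
- by move=> n; have /integrableP[] := itr n.
- by have /integrableP[] := iu.
- apply/aeW => y _; apply: cvg_near_cst.
  near=> n; rewrite clip_id//; near: n; exact: nbhs_infty_ger.
- by [].
- by apply/aeW => y n _; rewrite /= lee_fin clip_le.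
exact: h.
Unshelve. all: end_near. Qed.

Lemma clip_Cb n : Cb K (clip n \o u).
Proof.
apply: Lipb_Cb; split; first by exists L; exact: clip_lip.
apply: (@le_lt_trans _ _ n%:R%:E); last exact: ltry.
by apply: ge_ereal_sup => _ [y _ <-]; rewrite lee_fin /=; exact: clip_norm.
Qed.

End lipschitz_argument.

(** The flow identity holds for the clipped functions, which are in C_b.  Dominated
    convergence removes the clipping, first in the inner and then in the outer
    integral; the majorant T(s) |u| is Lipschitz, hence integrable. *)
Lemma opT_semigroup t s (u : X -> R) L x : lip_bound K u L ->
  (0 <= t)%R -> (0 <= s)%R ->
  T (t + s)%R (EFin \o u) x = T t (T s (EFin \o u)) x.
Proof.
move=> uL t0 s0.
have ts0 : (0 <= t + s)%R by rewrite addr_ge0.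
have h1 := opT_clip_cvg uL ts0 (x := x).
suff h2 : T (t + s)%R (EFin \o (clip n \o u)) x @[n --> \oo] -->
    T t (T s (EFin \o u)) x.
  by rewrite -(cvg_lim _ h1)// -(cvg_lim _ h2).
have mpsi y : measurable_fun [set: borel X] ((fun z : X => y + z)%R : borel X -> borel X).
  exact: measurable_borelDl.
have iT (v : X -> R) : lip_bound K v L -> (mu t).-integrable setT
    (fun y : borel X => T s (EFin \o v) (psi t x + (y : X))%R).
  move=> vL; rewrite (opTE vL s0).
  exact: shift_integrable (opT_lip vL s0) (mu_Pp t0).
have [|||||_ _ h] := @dominated_convergence _ _ _ (mu t) setT measurableT
  (fun n (y : borel X) => T s (EFin \o (clip n \o u)) (psi t x + (y : X))%R)
  (fun y : borel X => T s (EFin \o u) (psi t x + (y : X))%R)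
  (fun y : borel X => T s (EFin \o (fun z => `|u z|%R)) (psi t x + (y : X))%R).
- by move=> n; have /integrableP[] := iT _ (clip_lip uL n).
- by have /integrableP[] := iT _ uL.
- by apply/aeW => y _; exact: (opT_clip_cvg uL s0).
- exact: iT (norm_lip uL).
- apply/aeW => y n _; have itr := shift_integrable (psi s (psi t x + (y : X))%R) (clip_lip uL n) (mu_Pp s0).
  apply: (le_trans (le_abse_integral _ _ _)) => //.
    by have /integrableP[] := itr.
  by apply: integral_mono => z /=; rewrite lee_fin clip_le.
apply: cvg_trans h; apply: near_eq_cvg; near=> n => /=.
exact/esym/(mu_psi _ s0 t0)/clip_Cb/uL.
Unshelve. all: end_near. Qed.

(** Any random displacement D of a variable Y that has the reference law after applying
    K is a competitor in the supremum defining I.  Exceeding the budget a by delta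
    costs only L delta, because D can be shrunk to have p-norm a; this is used with
    almost optimal couplings, where phi could be +oo just above a. *)
Lemma opI_ge_displacement d (O : measurableType d) (P : probability O R) (Y D : O -> borel X)
    (t : R) (x : X) (u : X -> R) (L a delta : R) :
  (0 <= t)%R -> lip_bound K u L ->
  measurable_fun [set: O] Y -> measurable_fun [set: O] D ->
  \int[P]_w (`|Y w : X|%R)%:E < +oo ->
  (forall B : set X, measurable (B : set (borel X)) ->
    P [set w | B (K (Y w))] = mu t [set y | B (K (psi t x + y)%R)]) ->
  (0 <= a)%R -> (0 < delta)%R ->
  \int[P]_w ((`|D w : X| `^ p)%R)%:E <= ((a + delta) `^ p)%:E ->
  \int[P]_w (u ((Y w : X) + D w)%R)%:E - scaled c phi t a <=
    I t (EFin \o u) x + (L * delta)%:E.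
Proof.
move=> t0 uL mY mD iY lawK a0 d0 Da; have L0 : (0 <= L)%R by case: uL.
have ad0 : (0 < a + delta)%R by rewrite ltr_wpDl.
apply/lee_addgt0Pr => e e0.
(* shrinking the displacement by th lands exactly on the budget a *)
pose th := (a / (a + delta))%R.
have th0 : (0 <= th)%R by rewrite divr_ge0// ltW.
have th1 : (0 <= 1 - th)%R.
  by rewrite subr_ge0 ler_pdivrMr// mul1r lerDl ltW.
have thE : (th * (a + delta) = a)%R by rewrite divfK ?gt_eqF.
pose D' (w : O) : borel X := (th *: (D w : X))%R.
have mD' : measurable_fun [set: O] D' by exact: measurable_borelZ.
have D'a : \int[P]_w ((`|D' w : X| `^ p)%R)%:E <= (a `^ p)%:E.
  rewrite (eq_integral (fun w => (th `^ p)%:E * ((`|D w : X| `^ p)%R)%:E)); last first.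
    by move=> w _; rewrite /D' normrZ (ger0_norm th0) powRM// EFinM.
  rewrite ge0_integralZl ?lee_fin ?powR_ge0//; last first.
    by apply: measurable_EFin_powR; exact: measurable_borel_norm.
  rewrite (le_trans (lee_wpmul2l _ Da)) ?lee_fin ?powR_ge0//.
  by rewrite -powRM ?thE// ltW.
have [nu [nup cost_nu Enu]] := displace_reference Kcontr Xsep p_gt1 mY mD' iY (mu_Pp t0) lawK uL a0 D'a e0.
have W_a := wasserstein_le Xsep p_gt1 (mu_Pp t0) nup a0 cost_nu.
have iD : \int[P]_w (`|D w : X|%R)%:E <= (a + delta)%:E.
  by apply: (@mean_le_pnorm _ _ _ P p) => //; [exact: ltW|exact: measurable_borel_norm].
have iD' : \int[P]_w (`|D' w : X|%R)%:E <= a%:E.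
  by apply: (@mean_le_pnorm _ _ _ P p) => //; exact: measurable_borel_norm.
have shrink : \int[P]_w (u ((Y w : X) + D w)%R)%:E <=
    \int[P]_w (u ((Y w : X) + D' w)%R)%:E + (L * delta)%:E.
  apply: (@le_integral_add _ _ _ P _ _ (fun w => L * ((1 - th) * `|D w : X|))%R).
  - apply: (lip_integrable Kcontr uL); first exact: measurable_borelD.
    by apply: norm_addr_lty => //; exact: le_lt_trans iD (ltry _).
  - apply: (lip_integrable Kcontr uL); first exact: measurable_borelD.
    by apply: norm_addr_lty => //; exact: le_lt_trans iD' (ltry _).
  - by apply: measurable_funM => //; apply: measurable_funM => //; exact: measurable_borel_norm.
  - by move=> w; rewrite !mulr_ge0.
  - move=> w; rewrite (le_trans (lip_le Kcontr uL _ ((Y w : X) + D' w)%R))// lerD2l.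
    rewrite opprD addrACA subrr add0r /D' -{1}[D w]scale1r -scalerBl normrZ.
    by rewrite (ger0_norm th1).
  - apply: (@le_trans _ _ (\int[P]_w ((L * (1 - th))%:E * (`|D w : X|%R)%:E))).
      by apply: integral_mono => w; rewrite -EFinM mulrA.
    rewrite ge0_integralZl ?lee_fin ?mulr_ge0//; last first.
      by apply/measurable_EFinP; exact: measurable_borel_norm.
    rewrite (le_trans (lee_wpmul2l _ iD)) ?lee_fin ?mulr_ge0//.
    by rewrite -mulrA mulrBl mul1r thE addrAC subrr add0r.
apply: (@le_trans _ _ (\int[nu]_z (u (psi t x + (z : X))%R)%:E -
    scaled c phi t (wasserstein p (mu t) nu) + (L * delta)%:E + e%:E)); last first.
  by rewrite leeD2r// leeD2r//; apply: ereal_sup_ubound; exists nu.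
have fnu : \int[nu]_z (u (psi t x + (z : X))%R)%:E \is a fin_num.
  by apply: integrable_fin_num => //; exact: (shift_integrable _ uL nup).
apply: (@le_trans _ _ (\int[nu]_z (u (psi t x + (z : X))%R)%:E + e%:E + (L * delta)%:E -
    scaled c phi t a)).
  by rewrite leeD2r// (le_trans shrink)// leeD2r.
have W0 : (0 <= wasserstein p (mu t) nu)%R by exact: wasserstein_ge0.
have := @scaled_mono _ p c _ phi_pen t (wasserstein p (mu t) nu) a t0.
rewrite W0 W_a => /(_ isT).
have := scaled_ge0 c phi_pen t0 W0.
have := scaled_ge0 c phi_pen t0 a0.
move: fnu; case: (\int[nu]_z _) => // r _.
case: (scaled c phi t a) => // [sa _|_ _ _]; last by rewrite leNye.
by case: (scaled c phi t _) => // sW _; rewrite -?EFinD !lee_fin; lra.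
Qed.

Lemma dominated_norm_lty d (O : measurableType d) (P : probability O R)
    (Y Z : O -> borel X) (A B : R) :
  measurable_fun [set: O] Y -> measurable_fun [set: O] Z -> (0 <= A)%R -> (0 <= B)%R ->
  (forall w, `|Z w : X| <= A + B * `|Y w : X|)%R ->
  \int[P]_w (`|Y w : X|%R)%:E < +oo -> \int[P]_w (`|Z w : X|%R)%:E < +oo.
Proof.
move=> mY mZ A0 B0 ZAB iY.
have mYn : measurable_fun [set: O] (fun w => (`|Y w : X|%R)%:E).
  by apply/measurable_EFinP; exact: measurable_borel_norm.
apply: (@le_lt_trans _ _ (\int[P]_w (cst A%:E w + B%:E * (`|Y w : X|%R)%:E))).
  by apply: integral_mono => w; rewrite -EFinM -EFinD lee_fin.
rewrite ge0_integralD//; last 2 first.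
- by move=> w _; rewrite -EFinM lee_fin mulr_ge0.
- exact: measurable_funeM.
rewrite integral_cst//= probability_setT mule1 ge0_integralZl ?lee_fin//.
rewrite lte_add_pinfty ?ltry// lte_mul_pinfty ?lee_fin//.
Qed.

(** * Subadditivity of I in time *)

Section glue.
Variables (t s : R) (x : X) (u : X -> R) (L : R).
Hypothesis t0 : (0 <= t)%R.
Hypothesis s0 : (0 <= s)%R.
Hypothesis uL : lip_bound K u L.
Variables (nu : probability (borel X) R) (idx : borel X -> nat).
Hypothesis nu_Pp : Pp p nu.
Hypothesis midx : measurable_fun [set: borel X] idx.
Variables (nus : nat -> probability (borel X) R) (N : nat).
Hypothesis nus_Pp : forall i, Pp p (nus i).
Let W' i := wasserstein p (mu s) (nus i).
Hypothesis nus_tail : forall i, (N <= i)%N -> W' i = 0%R.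
Let W := wasserstein p (mu t) nu.
Let V := (\sum_(i < N) weight nu idx i * W' i `^ p)%R.
Let S := (V `^ p^-1)%R.

(** The composition of two perturbations as a single perturbation of mu_(t+s), for a
    second law that depends on z only through the index idx z.  Under M, the pair
    (y, z) has an almost optimal coupling of mu_t and nu as its law and, given it,
    (y', w) has an almost optimal coupling of mu_s and nus (idx z) as its law.  The
    slack d2 in the second cost is chosen such that the p-norm of w - y' exceeds S by
    at most delta. *)
Lemma opI_glue (f : borel X -> R) : nu.-integrable setT (EFin \o f) ->
  (forall z, (f z)%:E <=
     \int[nus (idx z)]_w (u (psi s (psi t x + (z : X)) + (w : X))%R)%:E) ->
  \int[nu]_z (f z)%:E - scaled c phi (t + s) (expR (c * s) * W + S)%R <=
    I (t + s)%R (EFin \o u) x.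
Proof.
move=> fint fle; have L0 : (0 <= L)%R by case: uL.
have ts0 : (0 <= t + s)%R by rewrite addr_ge0.
have W'0 i : (0 <= W' i)%R by exact: wasserstein_ge0.
have W0 : (0 <= W)%R by exact: wasserstein_ge0.
have V0 : (0 <= V)%R by apply: sumr_ge0 => i _; rewrite mulr_ge0 ?weight_ge0 ?powR_ge0.
have S0 : (0 <= S)%R by exact: powR_ge0.
have Sp : (S `^ p = V)%R by rewrite -powRrM mulVf ?gt_eqF// powRr1.
set ecs := expR (c * s); have ecs0 : (0 < ecs)%R by exact: expR_gt0.
apply/lee_addgt0Pr => e e0.
pose delta := (e / ((L + 1) * (ecs + 1)))%R.
have L1 : (0 < L + 1)%R by rewrite ltr_wpDl.
have ecs1 : (0 < ecs + 1)%R by rewrite addr_gt0.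
have delta0 : (0 < delta)%R by rewrite divr_gt0// mulr_gt0.
have powlt (a : R) : (0 <= a)%R -> (a `^ p < (a + delta) `^ p)%R.
  move=> a0; rewrite gt0_ltr_powR ?nnegrE ?addr_ge0 ?(ltW delta0)//.
  by rewrite ltrDl.
have [pi cpl pi_cost] := near_optimal_coupling Xsep p_gt1 (mu_Pp t0) nu_Pp (powlt _ W0).
pose d2 := ((S + delta) `^ p - V)%R.
have d20 : (0 < d2)%R by rewrite subr_gt0 -Sp powlt.
have /choice[pis pisP] i : exists pii : probability (borel X * borel X)%type R,
    coupling (mu s) (nus i) pii /\
    \int[pii]_yz ((`|(yz.1 : X) - (yz.2 : X)| `^ p)%R)%:E <= (W' i `^ p + d2)%:E.
  have h : (W' i `^ p < W' i `^ p + d2)%R by rewrite ltrDl.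
  by have [pii cp le] := near_optimal_coupling Xsep p_gt1 (mu_Pp s0) (nus_Pp i) h; exists pii.
have cpls i : coupling (mu s) (nus i) (pis i) by case: (pisP i).
pose O := ((borel X * borel X) * (borel X * borel X))%type.
have midx2 : measurable_fun [set: borel X * borel X] (fun z : borel X * borel X => idx z.2).
  exact: (measurableT_comp midx measurable_snd).
pose M : probability O R := mix pi pis midx2.
have m1 : measurable_fun [set: O] (fst : O -> _) by exact: measurable_fst.
have m2 : measurable_fun [set: O] (snd : O -> _) by exact: measurable_snd.
have m11 : measurable_fun [set: O] (fun w : O => w.1.1) by exact: (measurableT_comp measurable_fst m1).
have m12 : measurable_fun [set: O] (fun w : O => w.1.2) by exact: (measurableT_comp measurable_snd m1).
have m21 : measurable_fun [set: O] (fun w : O => w.2.1) by exact: (measurableT_comp measurable_fst m2).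
have m22 : measurable_fun [set: O] (fun w : O => w.2.2) by exact: (measurableT_comp measurable_snd m2).
have mpsi : measurable_fun [set: borel X] ((fun y : X => psi s (psi t x + y)%R) : borel X -> borel X).
  apply: (measurableT_comp _ (measurable_borelDl Xsep (psi t x))).
  by apply: continuous_borel; exact: psi_cont.
pose Y1 (w : O) : borel X := psi s (psi t x + (w.1.1 : X))%R.
pose Y (w : O) : borel X := ((Y1 w : X) + w.2.1)%R.
pose Z (w : O) : borel X := (psi s (psi t x + (w.1.2 : X)) + (w.2.2 : X))%R.
pose D (w : O) : borel X := ((Z w : X) - Y w)%R.
have mY1 : measurable_fun [set: O] Y1 by exact: (measurableT_comp mpsi m11).
have mY : measurable_fun [set: O] Y by exact: measurable_borelD.
have mZ : measurable_fun [set: O] Z.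
  by apply: measurable_borelD => //; exact: (measurableT_comp mpsi m12).
have mD : measurable_fun [set: O] D by exact: measurable_borelB.
have cst_pis (a : \bar R) i : 0 <= a -> \int[pis i]_z cst a z = a.
  by move=> a0; rewrite integral_cst//= probability_setT mule1.
have mnorm := measurable_borel_norm.
have mid := @measurable_id _ (borel X) setT.
have EM1 (g : borel X * borel X -> \bar R) :
    measurable_fun [set: borel X * borel X] g -> (forall z, 0 <= g z) ->
    \int[M]_w g w.1 = \int[pi]_z g z.
  move=> mg g0; rewrite ge0_integral_mix//; last exact: (measurableT_comp mg m1).
  by apply: eq_integral => z _; exact: (cst_pis (g z)).
have iy : \int[M]_w (`|w.1.1 : X|%R)%:E < +oo.
  rewrite (EM1 (fun z => (`|z.1 : X|%R)%:E))//; last first.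
    by apply/measurable_EFinP; exact: mnorm measurable_fst.
  rewrite (ge0_integral_fst cpl (g := fun y : borel X => (`|y : X|%R)%:E))//.
    exact: Pp_norm p_gt1 _ (mu_Pp t0).
  by apply/measurable_EFinP; exact: mnorm mid.
have iy' : \int[M]_w (`|w.2.1 : X|%R)%:E < +oo.
  rewrite ge0_integral_mix//; last by apply/measurable_EFinP; exact: mnorm.
  rewrite (eq_integral (cst (\int[mu s]_y (`|y : X|%R)%:E))); last first.
    move=> z _; rewrite (ge0_integral_fst (cpls _) (g := fun y : borel X => (`|y : X|%R)%:E))//.
    by apply/measurable_EFinP; exact: mnorm mid.
  by rewrite integral_cst//= probability_setT mule1; exact: Pp_norm p_gt1 _ (mu_Pp s0).
have iY : \int[M]_w (`|Y w : X|%R)%:E < +oo.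
  apply: norm_addr_lty => //.
  apply: (@dominated_norm_lty _ _ M (fun w : O => w.1.1) Y1 (`|psi s (psi t x)|)%R ecs) => //.
    exact: ltW.
  move=> w; rewrite /Y1 -lerBlDl (le_trans (lerB_dist _ _))//.
  by rewrite (le_trans (psi_lip _ _ s0))// [(_ + (w.1.1 : X))%R]addrC addrK.
have lawY (B : set X) : measurable (B : set (borel X)) ->
    M [set w | B (K (Y w))] = mu (t + s)%R [set y | B (K (psi (t + s) x + y)%R)].
  apply: (eq_law_K Kcontr mY (measurable_borelDl Xsep (psi (t + s) x))) => g g0 gb.
  have [Lg gL] := gb.1.
  have mg := lip_measurable Kcontr gL.
  have Tg := shift_integrable (psi t x)
    (opT_lip gL s0) (mu_Pp t0).
  rewrite mu_psi//; last exact: Lipb_Cb.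
  rewrite ge0_integral_mix//=; last 2 first.
    by move=> w; rewrite lee_fin.
    by apply/measurable_EFinP; exact: (measurableT_comp mg mY).
  rewrite (eq_integral (fun z : borel X * borel X => T s (EFin \o g) (psi t x + (z.1 : X))%R)); last first.
    move=> z _; rewrite -[RHS](ge0_integral_fst (cpls (idx z.2)))//.
      apply/measurable_EFinP.
      exact: (measurableT_comp mg (measurable_borelDl Xsep _)).
    by move=> y; rewrite lee_fin.
  apply: (ge0_integral_fst cpl (g := fun y : borel X => T s (EFin \o g) (psi t x + (y : X))%R)).
    rewrite (opTE gL s0).
    by have /integrableP[] := Tg.
  by move=> y; apply: integral_ge0 => z _; rewrite lee_fin.
have D_le (w : O) : (0 <= `|D w : X| <=
    ecs * `|(w.1.1 : X) - (w.1.2 : X)| + `|(w.2.1 : X) - (w.2.2 : X)|)%R.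
  rewrite normr_ge0/= /D /Z /Y /Y1 opprD addrACA (le_trans (ler_normD _ _))//.
  rewrite [X in (_ + X <= _)%R]distrC lerD2r (le_trans (psi_lip _ _ s0))//.
  by rewrite opprD addrACA subrr add0r distrC.
pose f1 (w : O) : R := (ecs * `|(w.1.1 : X) - (w.1.2 : X)|)%R.
pose f2 (w : O) : R := `|(w.2.1 : X) - (w.2.2 : X)|%R.
have mf1 : measurable_fun [set: O] f1.
  by apply: measurable_funM => //; apply: mnorm; exact: measurable_borelB.
have mf2 : measurable_fun [set: O] f2 by apply: mnorm; exact: measurable_borelB.
have f1_cost : \int[M]_w (f1 w `^ p)%:E <= ((ecs * (W + delta)) `^ p)%:E.
  rewrite (EM1 (fun z => ((ecs * `|(z.1 : X) - (z.2 : X)|) `^ p)%R%:E)); last 2 first.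
    by apply: measurable_EFin_powR; apply: measurable_funM => //; exact: measurable_dist.
    by move=> z; rewrite lee_fin powR_ge0.
  rewrite (eq_integral (fun z : borel X * borel X => (ecs `^ p)%:E * (`|(z.1 : X) - (z.2 : X)| `^ p)%R%:E)); last first.
    by move=> z _; rewrite -EFinM powRM// ltW.
  rewrite ge0_integralZl ?lee_fin ?powR_ge0//; last first.
    by apply: measurable_EFin_powR; exact: measurable_dist.
  rewrite (le_trans (lee_wpmul2l _ pi_cost)) ?lee_fin ?powR_ge0//.
  by rewrite -powRM ?(ltW ecs0)// addr_ge0// ltW.
have f2_cost : \int[M]_w (f2 w `^ p)%:E <= ((S + delta) `^ p)%:E.
  have mf2p : measurable_fun [set: O] (fun w => (f2 w `^ p)%:E).
    exact: measurable_EFin_powR.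
  have f2p0 w : 0 <= (f2 w `^ p)%:E by rewrite lee_fin powR_ge0.
  rewrite (ge0_integral_mix pi pis midx2 f2p0 mf2p).
  have mh (h : nat -> R) : measurable_fun [set: borel X] (fun z : borel X => (h (idx z))%:E).
    apply/measurable_EFinP.
    exact: (measurableT_comp (_ : measurable_fun setT h) midx).
  apply: (@le_trans _ _ (\int[pi]_z ((W' (idx z.2) `^ p)%R%:E + cst d2%:E z))).
    by apply: integral_mono => z; rewrite -EFinD; case: (pisP (idx z.2)).
  have W'p0 i : (0 <= W' i `^ p)%R by exact: powR_ge0.
  have W'pN i : (N <= i)%N -> (W' i `^ p = 0)%R.
    by move=> /nus_tail ->; rewrite powR0// gt_eqF.
  have mg := mh (fun i => W' i `^ p)%R.
  have g0 (z : borel X) : 0 <= (W' (idx z) `^ p)%:E by rewrite lee_fin.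
  have mg2 : measurable_fun [set: borel X * borel X] (fun z : borel X * borel X => (W' (idx z.2) `^ p)%:E).
    exact: (measurableT_comp mg measurable_snd).
  have g20 (z : borel X * borel X) : setT z -> 0 <= (W' (idx z.2) `^ p)%:E.
    by move=> _; exact: g0.
  have d2E (z : borel X * borel X) : setT z -> 0 <= cst d2%:E z.
    by move=> _; rewrite lee_fin ltW.
  rewrite (ge0_integralD pi measurableT g20 mg2 d2E (measurable_cst _)).
  rewrite (ge0_integral_snd cpl mg g0).
  have -> : \int[pi]_z cst d2%:E z = d2%:E.
    by rewrite integral_cst//= probability_setT mule1.
  rewrite (integral_index nu midx W'p0 W'pN) -EFinD lee_fin.
  by rewrite /d2 addrC subrK.
have D_cost : \int[M]_w ((`|D w : X| `^ p)%R)%:E <=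
    ((ecs * (W + delta) + (S + delta)) `^ p)%:E.
  have Wd0 : (0 < ecs * (W + delta))%R by rewrite mulr_gt0// ltr_wpDl.
  have Sd0 : (0 < S + delta)%R by rewrite ltr_wpDl.
  have f10 w : (0 <= f1 w)%R by rewrite mulr_ge0// ltW.
  have f20 w : (0 <= f2 w)%R by exact: normr_ge0.
  exact: (@pnorm_triangle _ _ _ M p p_gt1 f1 f2 _ _ _ Wd0 Sd0 mf1 mf2 (mnorm _ _ _ _ _ mD) f10 f20 D_le f1_cost f2_cost).
have a0 : (0 <= ecs * W + S)%R by rewrite addr_ge0// mulr_ge0// ltW.
have dd0 : (0 < (ecs + 1) * delta)%R by rewrite mulr_gt0.
have aE : (ecs * (W + delta) + (S + delta) = ecs * W + S + (ecs + 1) * delta)%R by ring.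
rewrite aE in D_cost.
have iD : \int[M]_w (`|D w : X|%R)%:E < +oo.
  apply: (@le_lt_trans _ _ (ecs * W + S + (ecs + 1) * delta)%:E); last exact: ltry.
  apply: (@mean_le_pnorm _ _ _ M p) => //; last exact: mnorm.
  by rewrite addr_ge0// ltW.
have ZE w : ((Y w : X) + D w = Z w :> X)%R by rewrite /D addrC subrK.
have iZ : \int[M]_w (`|Z w : X|%R)%:E < +oo.
  by under eq_integral do rewrite -ZE; exact: norm_addr_lty.
have := opI_ge_displacement ts0 uL mY mD iY lawY a0 dd0 D_cost.
under eq_integral do rewrite ZE.
have uZ := lip_integrable Kcontr uL mZ iZ.
have /integrableP[muZ uZ_lty] := uZ.
have muZabs : measurable_fun [set: O] (fun w => `|(u (Z w))%:E|) by exact: measurableT_comp.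
rewrite ge0_integral_mix// in uZ_lty.
have fle_int : \int[nu]_z (f z)%:E <= \int[M]_w (u (Z w))%:E.
  rewrite -(integral_snd cpl fint) (integral_mix midx2 muZ uZ_lty).
  apply: le_integral => //.
  - exact: (integrable_snd cpl fint).
  - exact: (integrable_fiber midx2 muZ uZ_lty).
  - move=> z _; apply: (le_trans (fle z.2)).
    rewrite -(integral_snd (cpls (idx z.2)))//.
    exact: shift_integrable uL (nus_Pp _).
move=> h; apply: (le_trans (leeD2r _ fle_int)); apply: (le_trans h).
rewrite leeD2l// lee_fin.
have -> : (L * ((ecs + 1) * delta) = e * (L / (L + 1)))%R.
  by rewrite /delta; field; rewrite !gt_eqF.
by rewrite -[leRHS]mulr1 ler_wpM2l ?(ltW e0)// ler_pdivrMr ?mul1r ?lerDl.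
Qed.

End glue.

(** With v = I(s) u and b = psi_t(x) + z in the cell of the centre q i, the law chosen
    for q i is still almost optimal at b, because v and the integrals of u against a
    fixed law are Lipschitz.  In the cells from N on, mu_s is used instead: by
    [opI_le_opT] this loses at most the constant C, and N is taken such that C times
    the mass of these cells is small.  What remains is the integrable minorant f
    required by [opI_glue]. *)
Lemma opI_comp (t s : R) (x : X) (u : X -> R) (L : R) :
  (0 <= t)%R -> (0 <= s)%R -> lip_bound K u L ->
  I t (I s (EFin \o u)) x <= I (t + s)%R (EFin \o u) x.
Proof.
move=> t0 s0 uL; have L0 : (0 <= L)%R by case: uL.
have ts0 : (0 <= t + s)%R by rewrite addr_ge0.
have vE := opIE uL s0.
have vL := opI_lip uL s0.
rewrite vE; set v := fine \o I s (EFin \o u) in vE vL *.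
set Lv := (L * expR (c * s))%R in vL; have Lv0 : (0 <= Lv)%R by case: vL.
apply: ge_ereal_sup => _ [nu nup <-].
have iv := shift_integrable (psi t x) vL nup.
set W := wasserstein p (mu t) nu.
have W0 : (0 <= W)%R by exact: wasserstein_ge0.
have := scaled_ge0 c phi_pen t0 W0.
case Er : (scaled c phi t W) => [r| |] // r0; last by rewrite addeNy leNye.
apply/lee_addgt0Pr => e e0.
pose eps := (e / 3)%R; have eps0 : (0 < eps)%R by rewrite divr_gt0.
have [C C0 CE] : exists2 C : R, (0 <= C)%R &
    s%:E * conjugate phi (expR (c * s) * L)%R = C%:E.
  have l0 : (0 <= expR (c * s) * L)%R by rewrite mulr_ge0// expR_ge0.
  have := conjugate_lty p_gt1 phi_pen l0.
  have := conjugate_ge0 phi_pen (expR (c * s) * L)%R.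
  case: (conjugate _ _) => // k k0 _; exists (s * k)%R => //.
  by rewrite mulr_ge0// -lee_fin.
have vC b : (v b)%:E <= T s (EFin \o u) b + C%:E.
  by rewrite -CE -[(v b)%:E]/((EFin \o v) b) -vE; exact: (opI_le_opT).
have [q qd] := dense_seq Xsep.
pose eta := (eps / (2 * (Lv + 1)))%R.
have Lv1 : (0 < Lv + 1)%R by rewrite ltr_wpDl.
have eta0 : (0 < eta)%R by rewrite divr_gt0// mulr_gt0.
have Lveta : (2 * (Lv * eta) <= eps)%R.
  have -> : (2 * (Lv * eta) = eps * (Lv / (Lv + 1)))%R.
    by rewrite /eta; field; rewrite gt_eqF.
  by rewrite -[leRHS]mulr1 ler_wpM2l ?(ltW eps0)// ler_pdivrMr ?mul1r ?lerDl.
pose idx (z : borel X) : nat := cell qd eta0 (psi t x + (z : X))%R.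
have midx : measurable_fun [set: borel X] idx.
  exact: (measurableT_comp (measurable_cell qd eta0) (measurable_borelDl Xsep (psi t x))).
(* an almost optimal law for each of the countably many centres q i, together
   with its penalty, which is finite because I(s) u is *)
have /choice[np npP] (i : nat) : exists np : probability (borel X) R * R,
    [/\ Pp p np.1, scaled c phi s (wasserstein p (mu s) np.1) = np.2%:E &
      (v (q i) + np.2)%:E <= \int[np.1]_w (u (psi s (q i) + (w : X))%R)%:E + eps%:E].
  have : (v (q i) - eps)%:E < I s (EFin \o u) (q i).
    by rewrite vE /= lte_fin ltrBlDr ltrDl.
  move=> /ereal_sup_gt[_ [nui nuip <-]].
  have Wi0 : (0 <= wasserstein p (mu s) nui)%R by exact: wasserstein_ge0.
  pose sc := scaled c phi s (wasserstein p (mu s) nui).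
  have sc0 : 0 <= sc := scaled_ge0 c phi_pen s0 Wi0.
  move=> h0; have {h0}h : (v (q i) - eps)%:E <
    \int[nui]_w (u (psi s (q i) + (w : X))%R)%:E - sc := h0.
  have sc_fin : sc \is a fin_num.
    rewrite ge0_fin_numE// ltey; apply/eqP => scy.
    by move: h; rewrite scy addeNy ltNge leNye.
  exists (nui, fine sc); split => //=; first by rewrite fineK.
  have iu := shift_integrable (psi s (q i)) uL nuip.
  have := integrable_fin_num measurableT iu.
  move: h; rewrite -(fineK sc_fin) => /=.
  case: (\int[nui]_w _) => // j; rewrite -EFinB lte_fin => h _.
  by rewrite -EFinD lee_fin; lra.
have [N tailN] := index_tail nu midx C0 eps0.
pose nus i := if (i < N)%N then (np i).1 else mu s.
pose Ph i : R := if (i < N)%N then (np i).2 else 0%R.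
have nus_Pp i : Pp p (nus i).
  by rewrite /nus; case: ifP => _; [case: (npP i)|exact: mu_Pp].
pose W' i := wasserstein p (mu s) (nus i).
have W'0 i : (0 <= W' i)%R by exact: wasserstein_ge0.
have nus_tail i : (N <= i)%N -> W' i = 0%R.
  by move=> Ni; rewrite /W' /nus ltnNge Ni/= wasserstein_diag.
have PhE i : scaled c phi s (W' i) = (Ph i)%:E.
  rewrite /W' /nus /Ph; case: ifP => _; first by case: (npP i).
  by rewrite wasserstein_diag// (scaled0 _ phi_pen).
have Ph0 i : (0 <= Ph i)%R by rewrite -lee_fin -(PhE i); exact: (scaled_ge0 c phi_pen s0 (W'0 i)).
have PhN i : (N <= i)%N -> Ph i = 0%R by rewrite /Ph ltnNge => ->.
pose V := (\sum_(i < N) weight nu idx i * W' i `^ p)%R.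
pose S := (V `^ p^-1)%R.
pose sg := (\sum_(i < N) weight nu idx i * Ph i)%R.
have S_sg : scaled c phi s S <= sg%:E.
  have := @sum_jensen _ (fun w => scaled c phi s (w `^ p^-1)%R) _ _
    (scaled_pcvx c p_gt1 phi_pen s0) N (weight nu idx) (fun i => W' i `^ p)%R
    (@weight_ge0 _ _ _ nu idx) _ (sum_weight_le1 nu midx N).
  rewrite -/V -/S => /(_ _ _ _)/le_trans; apply.
  - by move=> w w0; apply: (scaled_ge0 c phi_pen) => //; exact: powR_ge0.
  - by rewrite powR0 ?(scaled0 _ phi_pen)// invr_eq0 gt_eqF.
  - by move=> i; exact: powR_ge0.
  rewrite -sumEFin; apply: lee_sum => i _.
  rewrite -powRrM mulfV ?gt_eqF// powRr1; last exact: W'0.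
  by rewrite (PhE i).
pose f (z : borel X) := (v (psi t x + (z : X)) + Ph (idx z) - (2 * eps + C * (N <= idx z)%N%:R))%R.
have f_le z : (f z)%:E <=
    \int[nus (idx z)]_w (u (psi s (psi t x + (z : X)) + (w : X))%R)%:E.
  set b : X := (psi t x + (z : X))%R.
  have bq : (`|b - q (idx z)| < eta)%R by exact: (cellP qd eta0 b).
  rewrite /f -/b /Ph /nus; have [iN|iN] := ltnP (idx z) N; last first.
    rewrite addr0 mulr1; apply: (@le_trans _ _ ((v b)%:E - C%:E)).
      by rewrite -EFinB lee_fin opprD addrA lerB// gerBl ltW// mulr_gt0.
    by rewrite leeBlDr//; exact: vC.
  have [npp _ h] := npP (idx z).
  have Kbq : (`|K (b - q (idx z))| <= eta)%R by rewrite (le_trans (Kcontr _))// ltW.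
  have v_le : (v b <= v (q (idx z)) + Lv * eta)%R.
    rewrite -lerBlDl (le_trans (ler_norm _))//.
    by case: vL => _ /(_ b (q (idx z)))/le_trans; apply; rewrite ler_wpM2l.
  have u_le := shift_lip uL s0 (q (idx z)) b npp.
  have f1 := integrable_fin_num measurableT (shift_integrable (psi s b) uL npp).
  have f2 := integrable_fin_num measurableT
    (shift_integrable (psi s (q (idx z))) uL npp).
  have Kbq' : (Lv * `|K (q (idx z) - b)| <= Lv * eta)%R.
    by rewrite ler_wpM2l// -normrN -raddfN opprB.
  move: f1 f2 u_le h => /=.
  case: (integral (np (idx z)).1 setT (fun w : borel X => (u (psi s b + (w : X))%R)%:E)) => // j1 _.
  case: (integral _ _ _) => // j2 _; rewrite -!EFinD !lee_fin -/Lv => h1 h2.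
  by rewrite mulr0 addr0; lra.
have mh (h : nat -> R) : measurable_fun [set: borel X] (fun z : borel X => (h (idx z))%:E).
  apply/measurable_EFinP.
  exact: (measurableT_comp (_ : measurable_fun setT h) midx).
have nonneg_int (h : nat -> R) : (forall i, 0 <= h i)%R ->
    \int[nu]_z (h (idx z))%:E < +oo ->
    nu.-integrable setT (fun z : borel X => (h (idx z))%:E).
  move=> h0 h_lty; apply/integrableP; split; first exact: mh.
  rewrite (eq_integral (fun z : borel X => (h (idx z))%:E))//.
  by move=> z _; rewrite gee0_abs// lee_fin.
have i_Ph : nu.-integrable setT (fun z : borel X => (Ph (idx z))%:E).
  apply: (nonneg_int Ph Ph0).
  by rewrite (integral_index nu midx Ph0 PhN) ltry.
have i_tail : nu.-integrable setT (fun z : borel X => (C * (N <= idx z)%N%:R)%:E).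
  apply: (nonneg_int (fun i => C * (N <= i)%N%:R)%R); first by move=> i; rewrite mulr_ge0.
  exact: le_lt_trans tailN (ltry _).
have i_eps : nu.-integrable setT (cst (2 * eps)%:E : borel X -> _).
  exact: finite_measure_integrable_cst.
have fE : (EFin \o f) = (fun z : borel X => ((EFin \o (fun z : borel X => v (psi t x + (z : X))%R)) z +
    (Ph (idx z))%:E) - (cst (2 * eps)%:E z + (C * (N <= idx z)%N%:R)%:E)).
  by apply/funext => z; rewrite /f /= -!EFinD.
have i_f : nu.-integrable setT (EFin \o f).
  by rewrite fE; apply: integrableB => //; apply: integrableD.
have int_f : \int[nu]_z (f z)%:E =
    \int[nu]_z (v (psi t x + (z : X))%R)%:E + sg%:E -
    ((2 * eps)%:E + \int[nu]_z (C * (N <= idx z)%N%:R)%:E).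
  transitivity (\int[nu]_z (EFin \o f) z) => //; rewrite fE.
  rewrite integralB//; last 2 first.
    exact: integrableD.
    exact: integrableD.
  rewrite integralD// integralD// integral_cst//= probability_setT mule1.
  by rewrite (integral_index nu midx Ph0 PhN).
have glued := opI_glue t0 s0 uL nup midx
  nus_Pp nus_tail i_f f_le.
have sub := scaled_subadd c_ge0 phi_pen t0 s0 W0 (powR_ge0 V p^-1).
rewrite Er in sub; have {}sub := le_trans sub (leeD2l _ S_sg).
rewrite int_f in glued.
have fv := integrable_fin_num measurableT iv.
have fI := opI_fin uL ts0 x.
have tail0 : 0 <= \int[nu]_z (C * (N <= idx z)%N%:R)%:E.
  by apply: integral_ge0 => z _; rewrite lee_fin mulr_ge0.
have sc0 : 0 <= scaled c phi (t + s) (expR (c * s) * W + S)%R.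
  by apply: (scaled_ge0 c phi_pen) => //; rewrite addr_ge0 ?mulr_ge0 ?expR_ge0 ?powR_ge0.
move: fv fI tailN tail0 sc0 sub glued => /=.
case: (\int[nu]_z (v _)%:E) => // b _; case: (I (t + s)%R _ _) => // k _.
case: (\int[nu]_z (C * _)%:E) => // tl; rewrite lee_fin => tle _.
case: (scaled _ _ _ _) => // rho _.
move=> h1 h2; move: h1 h2 tle; rewrite -?EFinN -?EFinD -?EFinN -?EFinD !lee_fin /eps.
lra.
Qed.

(** * Iterates and conclusion *)

Lemma opT_le_iter (k : nat) (r h : R) (u : X -> R) (L : R) (x : X) :
  (0 <= r)%R -> (0 <= h)%R -> lip_bound K u L ->
  T (r + k%:R * h)%R (EFin \o u) x <= iter k (I h) (I r (EFin \o u)) x.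
Proof.
move=> r0 h0 uL; elim: k x => [|k IHk] x /=.
  by rewrite mul0r addr0 opT_le_opI.
have rkh0 : (0 <= r + k%:R * h)%R by rewrite addr_ge0// mulr_ge0.
rewrite (_ : r + k.+1%:R * h = h + (r + k%:R * h))%R; last by rewrite -natr1; ring.
rewrite (opT_semigroup x uL h0 rkh0).
apply: le_trans (opT_le_opI _ _ h0) _.
by apply: opI_mono => y; exact: IHk.
Qed.

Lemma iter_le_opI (k : nat) (r h : R) (u : X -> R) (L : R) (x : X) :
  (0 <= r)%R -> (0 <= h)%R -> lip_bound K u L ->
  iter k (I h) (I r (EFin \o u)) x <= I (r + k%:R * h)%R (EFin \o u) x.
Proof.
move=> r0 h0 uL; elim: k x => [|k IHk] x /=; first by rewrite mul0r addr0.
have rkh0 : (0 <= r + k%:R * h)%R by rewrite addr_ge0// mulr_ge0.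
rewrite (_ : r + k.+1%:R * h = h + (r + k%:R * h))%R; last by rewrite -natr1; ring.
apply: le_trans (opI_comp x h0 rkh0 uL).
by apply: opI_mono => y; exact: IHk.
Qed.

End operator_theory.

Theorem mainTheorem3 (R : realType) (X : completeNormedModType R)
  (Xsep : separable X)
  (K : {linear X -> X})
  (Kcompact : forall r : R, 0 <= r -> compact (K @` [set x : X | `|x| <= r]))
  (Kdense : dense (range K))
  (Kcontr : forall x : X, `|K x| <= `|x|)
  (p : R) (p_gt1 : 1 < p)
  (mu : R -> probability (borel X) R) (psi : R -> X -> X)
  (mu_Pp : forall t : R, 0 <= t -> Pp p (mu t))
  (psi_cont : forall t : R, 0 <= t -> continuous (psi t))
  (mu_psi : forall (s t : R) (u : X -> R) (x : X),
     0 <= s -> 0 <= t -> Cb K u ->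
     (\int[mu (t + s)%R]_y
        (u (psi (t + s)%R x + y)%R)%:E =
      \int[mu t]_yt \int[mu s]_ys
        (u (psi s (psi t x + yt) + ys)%R)%:E)%E)
  (c : R) (c_ge0 : 0 <= c)
  (A1 : forall (t : R) (x1 x2 : X), 0 <= t ->
     `|psi t x1 - psi t x2| <= expR (c * t) * `|x1 - x2|)
  (A2_comm : forall (t : R) (x : X), 0 <= t -> K (psi t x) = psi t (K x))
  (A2_zero : forall x : X, psi 0 x = x)
  (A2_lim : forall r : R, 0 <= r ->
     supnorm [set x : X | `|x| <= r] (fun x => psi h (K x) - K x)
       @[h --> 0^'+] --> 0%E)
  (A3 : moment p (mu h) @[h --> 0^'+] --> 0%E)
  (phi : R -> \bar R) (phi_pen : penalisation p phi)
  (u : X -> R) (u_Lip : Lip K u) (t : R) (t_ge0 : 0 <= t) (x : X) :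
  let Ttu := opT mu psi t (EFin \o u) x in
  let Itu := opI p c phi mu psi t (EFin \o u) x in
  let Stu := opS p c phi mu psi t (EFin \o u) x in
  ([/\ Ttu <= Stu, Stu <= Itu, Stu - Ttu <= Itu - Ttu &
      Itu - Ttu <= t%:E * conjugate phi (expR (c * t) * lip_norm K u)%R])%E.
Proof.
have uL := lip_norm_bound u_Lip.
have dyadic n : let h : R := 2 ^- n in let k := Num.truncn (t * 2 ^+ n) in
    0 <= h /\ 0 <= t - k%:R * h.
  move=> h k; have h0 : 0 < 2 ^+ n :> R by rewrite exprn_gt0.
  split; first by rewrite invr_ge0 ltW.
  by rewrite subr_ge0 ler_pdivrMr// truncn_le// mulr_ge0// ltW.
move=> Ttu Itu Stu.
have T_le_S : (Ttu <= Stu)%E.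
  apply: le_ereal_inf_tmp => _ [n _ <-]; have [h0 r0] := dyadic n.
  rewrite /Ttu -[X in opT _ _ X](subrK ((Num.truncn (t * 2 ^+ n))%:R * 2 ^- n) t).
  exact: (opT_le_iter Xsep Kcontr p_gt1 phi_pen mu_Pp A1 A2_comm mu_psi _ x r0 h0 uL).
have S_le_I : (Stu <= Itu)%E.
  (* the coarsest partition, of step 1, is enough for the upper bound *)
  have [h0 r0] := dyadic 0%N.
  apply: (@le_trans _ _ (opIn p c phi mu psi 0 t (EFin \o u) x)).
    by apply: ereal_inf_lbound; exists 0%N.
  rewrite /Itu -[X in opI _ _ _ _ _ X](subrK ((Num.truncn (t * 2 ^+ 0))%:R * 2 ^- 0) t).
  exact: (iter_le_opI Xsep Kcontr p_gt1 c_ge0 phi_pen mu_Pp psi_cont A1 A2_comm mu_psi _ x r0 h0 uL).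
split => //; first by rewrite leeD2r.
have T_fin : Ttu \is a fin_num := opT_fin Xsep Kcontr p_gt1 psi mu_Pp uL t_ge0 x.
rewrite leeBlDl//.
exact: (opI_le_opT Xsep Kcontr p_gt1 c phi psi mu_Pp uL t_ge0 x).
Qed.
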